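(* Let $n\geq 2$ and let $g$ be chosen from the Haar measure of $USp(2n,\mathbb{C})$. Let $W(g)$ be the trace of $g$. Then for all real $x_0$, $$\left| \mathbb{P}(W \leq x_0) - \frac{1}{\sqrt{2 \pi}} \int_{-\infty}^{x_0} e^{-\frac{x^2}{2}}\, dx \right| \leq \frac{\sqrt{2}}{n}.$$
   Context: $USp(2n,\mathbb{C})$ is the compact group of $2n\times 2n$ unitary symplectic matrices; the trace is that of the $2n$-dimensional defining representation. Haar measure is normalized to be a probability measure. *)

(* Defs.v *)
From HB Require Import structures.
From mathcomp Require Import all_boot all_order all_algebra.
From mathcomp Require Import complex.
From mathcomp Require Import all_classical all_reals all_analysis.

Set Implicit Arguments.
Unset Strict Implicit.
Unset Printing Implicit Defensive.

Import Order.TTheory GRing.Theory Num.Theory.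
Import numFieldTopology.Exports numFieldNormedType.Exports.

Local Open Scope classical_set_scope.
Local Open Scope ring_scope.
Local Open Scope sesquilinear_scope.

Definition symplectic_form (R : pzRingType) (n : nat) : 'M[R]_(n + n) :=
  block_mx 0 1%:M (- 1%:M) 0.

(* [trmx], not the conjugate transpose: the preserved form is complex bilinear. *)
Definition symplecticmx (R : pzRingType) (n : nat) : {pred 'M[R]_(n + n)} :=
  [pred g | g^T *m symplectic_form R n *m g == symplectic_form R n].

Arguments symplecticmx R n : clear implicits.

Definition uspmx (C : numClosedFieldType) (n : nat) : {pred 'M[C]_(n + n)} :=
  [pred g | (g \is unitarymx) && (g \in symplecticmx _ n)].

Arguments uspmx C n : clear implicits.

Record USp (C : numClosedFieldType) (n : nat) := MkUSp {
  usp_val :> 'M[C]_(n + n) ;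
  usp_valP : usp_val \in uspmx C n }.

HB.instance Definition _ (C : numClosedFieldType) (n : nat) :=
  [isSub of USp C n for @usp_val C n].
HB.instance Definition _ (C : numClosedFieldType) (n : nat) :=
  [Choice of USp C n by <:].

Section USpGroup.
Context (C : numClosedFieldType) (n : nat).
Implicit Types g h : 'M[C]_(n + n).

Lemma uspmx1 : 1%:M \in uspmx C n.
Proof.
apply/andP; split.
  by apply/unitarymxP; rewrite trmx1 map_mx1 mulmx1.
by rewrite inE trmx1 mul1mx mulmx1.
Qed.

Lemma uspmxM g h : g \in uspmx C n -> h \in uspmx C n -> g *m h \in uspmx C n.
Proof.
move=> /andP[gu /eqP gs] /andP[hu /eqP hs]; apply/andP; split.
  exact: mul_unitarymx.
apply/eqP; rewrite trmx_mul -[RHS]hs -[in RHS]gs.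
by rewrite !mulmxA.
Qed.

Lemma uspmxV g : g \in uspmx C n -> invmx g \in uspmx C n.
Proof.
move=> /andP[gu /eqP gs]; have gU := unitarymx_unit gu; apply/andP; split.
  by rewrite (invmx_unitary gu) trmxC_unitary.
apply/eqP; rewrite -[in LHS]gs -!mulmxA mulmxV // mulmx1 mulmxA.
by rewrite -trmx_mul mulmxV // trmx1 mul1mx.
Qed.

Definition usp_one : USp C n := MkUSp uspmx1.
Definition usp_mul (g h : USp C n) : USp C n :=
  MkUSp (uspmxM (usp_valP g) (usp_valP h)).
Definition usp_inv (g : USp C n) : USp C n := MkUSp (uspmxV (usp_valP g)).

Lemma usp_mulA : associative usp_mul.
Proof. by move=> f g h; apply: val_inj; rewrite /= mulmxA. Qed.

Lemma usp_mul1 : left_id usp_one usp_mul.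
Proof. by move=> g; apply: val_inj; rewrite /= mul1mx. Qed.

Lemma usp_mulr1 : right_id usp_one usp_mul.
Proof. by move=> g; apply: val_inj; rewrite /= mulmx1. Qed.

Lemma usp_unitmx (g : USp C n) : usp_val g \in unitmx.
Proof. by case/andP: (usp_valP g) => /unitarymx_unit. Qed.

Lemma usp_mulV : left_inverse usp_one usp_inv usp_mul.
Proof. by move=> g; apply: val_inj; rewrite /= mulVmx ?usp_unitmx. Qed.

Lemma usp_mulrV : right_inverse usp_one usp_inv usp_mul.
Proof. by move=> g; apply: val_inj; rewrite /= mulmxV ?usp_unitmx. Qed.

End USpGroup.

HB.instance Definition _ (C : numClosedFieldType) (n : nat) :=
  isGroup.Build (USp C n) (@usp_mulA C n) (@usp_mul1 C n) (@usp_mulr1 C n)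
    (@usp_mulV C n) (@usp_mulrV C n).

HB.instance Definition _ (C : numClosedFieldType) (n : nat) :=
  isPointed.Build (USp C n) (usp_one C n).

HB.instance Definition _ (C : numClosedFieldType) (n : nat) :=
  Topological.copy (USp C n) (initial_topology (@usp_val C n)).

Notation USpBorel C n := (g_sigma_algebraType (@open (USp C n))).

(* Every finite Borel measure on the compact metrizable group [USp R[i] n] is
   Radon, so left invariance is all that singles out the Haar probability. *)
Definition is_haar (R : realType) (n : nat)
    (P : probability (USpBorel R[i] n) R) : Prop :=
  forall (h : USp R[i] n) (A : set (USp R[i] n)),
    measurable (A : set (USpBorel R[i] n)) ->
    P [set (h * g)%g | g in A] = P A.

(* The trace of a unitary symplectic matrix is real, see [uspW_trace]. *)
Definition uspW (R : realType) (n : nat) (g : USp R[i] n) : R :=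
  complex.Re (\tr (usp_val g)).

Lemma uspW_trace (R : realType) (n : nat) (g : USp R[i] n) :
  \tr (usp_val g) = (uspW g)%:C%C.
Proof.
rewrite /uspW RRe_real //; apply/CrealP.
case/andP: (usp_valP g) => gu /eqP gs.
set J := symplectic_form _ n in gs.
have JU : J *m (- J) = 1%:M.
  rewrite /J /symplectic_form opp_block_mx mulmx_block scalar_mx_block.
  by rewrite oppr0 opprK !(mulmxN, mulNmx) !(mul0mx, mulmx0, mulmx1) ?opprK
             ?oppr0 !(addr0, add0r).
have -> : (\tr (usp_val g))^* = \tr ((usp_val g) ^t*).
  by rewrite trace_map_mx mxtrace_tr.
have -> : (usp_val g)^t* = invmx (usp_val g) by rewrite invmx_unitary.
have gU := unitarymx_unit gu.
have -> : invmx (usp_val g) = (- J) *m ((usp_val g)^T *m J).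
  have := congr1 (fun M => - J *m (M *m invmx (usp_val g))) gs.
  rewrite -!mulmxA mulmxV // mulmx1 => ->.
  by rewrite !mulmxA (mulmx1C JU) mul1mx.
by rewrite mxtrace_mulC -mulmxA JU mulmx1 mxtrace_tr.
Qed.

(* Main.v *)
(* Write N = 2n, W = tr g, p2 = tr g^2, p4 = tr g^4. Haar measure is invariant
   under left translations by curves t |-> h_t with h_0 = 1 and h_0' = X, for X
   in the Lie algebra, so the mean of d/dt F(h_t g) at t = 0 vanishes. Summing
   such identities over dual bases of the complexified Lie algebra gives
     E[(N + 1) W f(W)] = E[f'(W) (N - p2)]
   for f of class C^{1,1}, together with
     E[(N + 1) p2 + W^2 + N] = 0,
     E[((N + 1) p2 + W^2 + N) p2 + 2 (p4 - N)] = 0.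
   Taking f = id one finds E W^2 = 1 and E p2 = -1, and the trivial bounds
   |p2|, |p4| <= N then give E p2^2 <= 6 N / (N + 1). If f solves the Stein
   equation f'(x) - x f(x) = h(x) - E h(Z), Z standard normal, 0 <= h <= 1, then
   |f'| <= 1 and
     |E h(W) - E h(Z)| = |E[f'(W) (1 + p2)]| / (N + 1)
                      <= sqrt (E (1 + p2)^2) / (N + 1) <= sqrt 2 / n.
   Piecewise linear h squeezing the indicator of ]-oo, x0] conclude. *)

Require Import Defs.
From mathcomp Require Import all_boot all_order all_algebra.
From mathcomp Require Import complex.
From mathcomp Require Import all_classical all_reals all_analysis.
From mathcomp Require Import measurable_realfun.
From mathcomp Require Import ring lra.
Import Order.TTheory GRing.Theory Num.Theory.
Import numFieldTopology.Exports numFieldNormedType.Exports.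
Import ComplexField.Normc.
Local Open Scope classical_set_scope.
Local Open Scope ring_scope.

(** * The standard normal distribution and Stein's equation *)

(** Two features shape the formal argument. First, differentiation under the Haar integral is
    replaced by a first-order expansion along a flow with error at most [K * t ^+ 2], uniformly on
    the group. This is why [f] has to be C^{1,1}, hence why the test functions are Lipschitz ramps:
    the Stein solution of an indicator has a derivative with a jump. The slope of a ramp affects
    only the constant [K], which disappears as [t] tends to 0; the final bound uses [|f'| <= 1]
    alone, so letting the ramp steepen costs nothing. Second, the sum over dual bases is carried out
    without choosing a basis of the Lie algebra: all matrix units are projected to it. These
    projections are not skew-Hermitian and generate no curve in the compact group, so the vanishing
    of means is first proved on the compact Lie algebra and then extended by complex linearity. The
    constant leaves room: [E (1 + p2)^2 < 5] is enough against [2 (N + 1)^2 / n^2 > 8], so the crude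
    moment bounds suffice. *)

Section Gauss.
Context {R : realType}.
Notation mu := (@lebesgue_measure R).

Definition gauss_pdf (x : R) : R :=
  (Num.sqrt (2 * pi))^-1 * expR (- (x ^+ 2 / 2)).

Lemma sqrt2pi_gt0 : 0 < Num.sqrt (2 * pi) :> R.
Proof. by rewrite sqrtr_gt0 mulr_gt0 ?pi_gt0. Qed.

Lemma gauss_pdf_gt0 x : 0 < gauss_pdf x.
Proof. by rewrite mulr_gt0 ?expR_gt0 ?invr_gt0 ?sqrt2pi_gt0. Qed.

Lemma gauss_pdf_normal : gauss_pdf = normal_pdf 0 1.
Proof.
apply/funext => x; rewrite normal_pdfE ?oner_eq0// /normal_peak /normal_fun.
rewrite /gauss_pdf subr0 expr1n mul1r mulNr -[pi *+ 2]mulr_natl.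
by rewrite (_ : 1 *+ 2 = 2 :> R).
Qed.

Lemma is_derive_gauss_pdf (x : R)
  : is_derive x 1 gauss_pdf (- (x * gauss_pdf x)).
Proof.
rewrite /gauss_pdf; apply: is_derive_eq.
rewrite /GRing.scale /=; field.
by rewrite lt0r_neq0 ?sqrt2pi_gt0.
Qed.

Lemma gauss_pdf_le1 x : gauss_pdf x <= 1.
Proof.
rewrite /gauss_pdf mulrC ler_pdivrMr ?sqrt2pi_gt0// mul1r.
apply: (@le_trans _ _ 1).
  by rewrite -expR0 ler_expR lerNl oppr0 divr_ge0 ?sqr_ge0.
rewrite -[leLHS]sqrtr1 ler_wsqrtr//.
have := @pi_ge2 R; lra.
Qed.

Lemma continuous_gauss_pdf : continuous gauss_pdf.
Proof.
by rewrite gauss_pdf_normal; apply: continuous_normal_pdf; rewrite oner_eq0.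
Qed.

Lemma integrable_gauss_pdf : mu.-integrable setT (EFin \o gauss_pdf).
Proof. by rewrite gauss_pdf_normal; exact: integrable_normal_pdf. Qed.

Lemma integrable_gauss_exp :
  mu.-integrable setT (EFin \o (fun x : R => expR (- (x ^+ 2 / 2)))).
Proof.
rewrite (_ : (fun x => _) = (fun x => Num.sqrt (2 * pi) * gauss_pdf x)).
  exact: (integrableZl measurableT _ integrable_gauss_pdf).
apply/funext => x; rewrite /gauss_pdf mulrA mulfV ?mul1r//.
by rewrite gt_eqF ?sqrt2pi_gt0.
Qed.

Lemma Rintegral_gauss_pdf : \int[mu]_x gauss_pdf x = 1.
Proof.
rewrite gauss_pdf_normal /Rintegral.
by rewrite integral_normal_pdf.
Qed.

Lemma cvgy_gauss_pdf : gauss_pdf x @[x --> +oo] --> (0 : R).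
Proof.
rewrite /gauss_pdf -[X in _ --> X](mulr0 (Num.sqrt (2 * pi))^-1).
apply: cvgMr.
apply: (cvg_comp (fun x : R => x ^+ 2 / 2) (fun x => expR (- x)));
  last exact: cvgr_expR.
apply: gt0_cvgMly; last exact: cvgr_expr2.
by rewrite invr_gt0.
Qed.

End Gauss.

(** * The normal distribution function and Mills' inequalities *)

Section GaussPartial.
Context {R : realType}.
Notation mu := (@lebesgue_measure R).

Lemma is_derive_Rintegral_Ny (u : R -> R) (x : R) :
  mu.-integrable setT (EFin \o u) -> {for x, continuous u} ->
  is_derive x 1 (fun y => \int[mu]_(t in `]-oo, y]) u t) (u x).
Proof.
move=> iu cu.
have [|||dF <-] := @continuous_FTC1 R u (BInfty _ true) x (x + 1) _ _ _ cu.
- by rewrite ltrDl.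
- exact: integrableS iu.
- by rewrite ltNyr.
by rewrite derive1E; exact: derivableP.
Qed.

Lemma gauss_pdfN (x : R) : gauss_pdf (- x) = gauss_pdf x.
Proof. by rewrite /gauss_pdf sqrrN. Qed.

Definition gauss_cdf (x : R) : R := \int[mu]_(t in `]-oo, x]) gauss_pdf t.

Lemma is_derive_gauss_cdf (x : R) : is_derive x 1 gauss_cdf (gauss_pdf x).
Proof.
apply: is_derive_Rintegral_Ny; first exact: integrable_gauss_pdf.
exact: continuous_gauss_pdf.
Qed.

Lemma Rintegral_tail (u : R -> R) (x : R) :
  mu.-integrable setT (EFin \o u) ->
  \int[mu]_t u t - \int[mu]_(t in `]-oo, x]) u t =
    \int[mu]_(t in `[x, +oo[) u t.
Proof.
move=> iu; rewrite -set_itvNyy Rintegral_itvB ?set_itvNyy//.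
by rewrite Rintegral_itv_obnd_cbnd//; exact: integrableS iu.
Qed.

Lemma gauss_cdf_tail (x : R) :
  1 - gauss_cdf x = \int[mu]_(t in `[x, +oo[) gauss_pdf t.
Proof.
by rewrite -Rintegral_gauss_pdf Rintegral_tail//; exact: integrable_gauss_pdf.
Qed.

Lemma gauss_cdf_le1 (x : R) : gauss_cdf x <= 1.
Proof.
rewrite -subr_ge0 gauss_cdf_tail.
by apply: Rintegral_ge0 => t _; exact/ltW/gauss_pdf_gt0.
Qed.

Lemma gauss_cdfN (x : R) : gauss_cdf (- x) = 1 - gauss_cdf x.
Proof.
rewrite gauss_cdf_tail /gauss_cdf /Rintegral ge0_integration_by_substitutionNy.
- by congr fine; apply: eq_integral => t _ /=; rewrite gauss_pdfN.
- exact/continuous_subspaceT/continuous_gauss_pdf.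
- by move=> t _; exact/ltW/gauss_pdf_gt0.
Qed.

Lemma continuous_id_gauss_pdf : continuous (fun x : R => x * gauss_pdf x).
Proof.
by move=> x; apply: cvgM; [exact: cvg_id|exact: continuous_gauss_pdf].
Qed.

Lemma integral_id_gauss_pdf (x : R) : 0 <= x ->
  (\int[mu]_(t in `[x, +oo[) (t * gauss_pdf t)%:E = (gauss_pdf x)%:E)%E.
Proof.
move=> x0.
rewrite (@ge0_continuous_FTC2y _ _ (fun t => - gauss_pdf t) _ 0).
- by rewrite sub0e EFinN oppeK.
- move=> t xt; apply: mulr_ge0; first exact: le_trans xt.
  exact/ltW/gauss_pdf_gt0.
- exact/continuous_subspaceT/continuous_id_gauss_pdf.
- by rewrite -oppr0; apply: cvgN; exact: cvgy_gauss_pdf.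
- move=> t _; apply: derivableN.
  exact: (@ex_derive _ _ _ _ _ _ _ (is_derive_gauss_pdf t)).
- by apply: cvgN; apply: cvg_at_right_filter; exact: continuous_gauss_pdf.
- move=> t _; rewrite derive1E deriveN.
    by rewrite (@derive_val _ _ _ _ _ _ _ (is_derive_gauss_pdf t)) opprK.
  exact: (@ex_derive _ _ _ _ _ _ _ (is_derive_gauss_pdf t)).
Qed.

(** For [t >= x] the integrand [x * gauss_pdf t] is at most [t * gauss_pdf t], whose primitive is
    [- gauss_pdf]. For negative [x] the left side is nonpositive. *)
Lemma mills (x : R) : x * (1 - gauss_cdf x) <= gauss_pdf x.
Proof.
have [x0|/ltW x0] := leP 0 x; last first.
  rewrite (@le_trans _ _ 0)//; last exact/ltW/gauss_pdf_gt0.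
  by rewrite mulr_le0_ge0// subr_ge0 gauss_cdf_le1.
rewrite gauss_cdf_tail -lee_fin -integral_id_gauss_pdf//.
have ip : mu.-integrable `[x, +oo[ (EFin \o gauss_pdf).
  by apply: integrableS integrable_gauss_pdf.
rewrite -RintegralZl// /Rintegral fineK; last first.
  apply: integrable_fin_num => //.
  have -> : (fun t => (x * gauss_pdf t)%:E) =
    (fun t => x%:E * (EFin \o gauss_pdf) t)%E.
    by apply/funext => t; rewrite /= EFinM.
  exact: integrableZl.
apply: ge0_le_integral => //.
- by move=> t _; rewrite lee_fin mulr_ge0//; exact/ltW/gauss_pdf_gt0.
- apply/measurable_EFinP; apply: measurable_funTS.
  by apply: measurable_funM => //; exact: continuous_measurable_fun
    continuous_gauss_pdf.
- apply/measurable_EFinP; apply: measurable_funTS.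
  exact: continuous_measurable_fun continuous_id_gauss_pdf.
- move=> t /=; rewrite in_itv/= andbT => xt.
  by rewrite lee_fin ler_wpM2r//; exact/ltW/gauss_pdf_gt0.
Qed.

Lemma millsN (x : R) : - x * gauss_cdf x <= gauss_pdf x.
Proof. by have := mills (- x); rewrite gauss_cdfN gauss_pdfN opprB subrKC. Qed.

(** The density is at most 1. This crude modulus of continuity is enough, since [e] is arbitrary in
    [kolmogorov_of_ramp]. *)
Lemma gauss_cdfD_le (x e : R) : 0 <= e -> gauss_cdf (x + e) <= gauss_cdf x + e.
Proof.
rewrite le_eqVlt => /predU1P[<-|e0]; first by rewrite !addr0.
have xe : x < x + e by rewrite ltrDl.
have [||c _] := @MVT _ gauss_cdf gauss_pdf x (x + e) xe.
- by move=> t _; exact: is_derive_gauss_cdf.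
- apply: derivable_within_continuous => t _.
  exact: (@ex_derive _ _ _ _ _ _ _ (is_derive_gauss_cdf t)).
move/eqP; rewrite subr_eq => /eqP ->; rewrite addrC lerD2l.
by rewrite [x + e]addrC addrK ler_piMl ?gauss_pdf_le1// ltW.
Qed.

End GaussPartial.
Section SteinSolution.
Context {R : realType} (h : R -> R).
Notation mu := (@lebesgue_measure R).
Hypotheses (ch : continuous h) (h0 : forall x, 0 <= h x)
  (h1 : forall x, h x <= 1).

Definition gauss_mean : R := \int[mu]_t (h t * gauss_pdf t).

Let A (x : R) : R := \int[mu]_(t in `]-oo, x]) (h t * gauss_pdf t).

(** Multiplied by [gauss_pdf], the left side of Stein's equation becomes the derivative of
    [f * gauss_pdf]; integrating from minus infinity gives this quotient. *)
Definition stein_sol (x : R) : R :=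
  (A x - gauss_mean * gauss_cdf x) / gauss_pdf x.

(** Stein's equation solved for the derivative, so that the equation holds by unfolding;
    [is_derive_stein_sol] shows that this is the derivative. *)
Definition stein_sol' (x : R) : R := x * stein_sol x + h x - gauss_mean.

Let hg0 t : 0 <= h t * gauss_pdf t.
Proof. exact: mulr_ge0 (h0 t) (ltW (gauss_pdf_gt0 t)). Qed.

Let hgle t : h t * gauss_pdf t <= gauss_pdf t.
Proof. by rewrite ler_piMl// ltW// gauss_pdf_gt0. Qed.

Let chg : continuous (fun t => h t * gauss_pdf t).
Proof. by move=> x; apply: cvgM; [exact: ch|exact: continuous_gauss_pdf]. Qed.

Lemma integrable_gauss_mean : mu.-integrable setT
  (EFin \o (fun t => h t * gauss_pdf t)).
Proof.
apply: (le_integrable _ _ _ integrable_gauss_pdf) => //.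
  by apply/measurable_EFinP; exact: continuous_measurable_fun chg.
move=> t _ /=; rewrite lee_fin !ger0_norm//; exact/ltW/gauss_pdf_gt0.
Qed.

Let ihg (D : set R) : measurable D ->
  mu.-integrable D (EFin \o (fun t => h t * gauss_pdf t)).
Proof. by move=> mD; apply: integrableS integrable_gauss_mean. Qed.

Let ig (D : set R) : measurable D -> mu.-integrable D (EFin \o gauss_pdf).
Proof. by move=> mD; apply: integrableS integrable_gauss_pdf. Qed.

Let A_ge0 x : 0 <= A x.
Proof. exact: Rintegral_ge0. Qed.

Let A_le x : A x <= gauss_cdf x.
Proof. by apply: le_Rintegral => //; [exact: ihg|exact: ig]. Qed.

Let tail_ge0 x : 0 <= gauss_mean - A x.
Proof.
by rewrite Rintegral_tail ?Rintegral_ge0//; exact: integrable_gauss_mean.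
Qed.

Let tail_le x : gauss_mean - A x <= 1 - gauss_cdf x.
Proof.
rewrite Rintegral_tail ?gauss_cdf_tail; last exact: integrable_gauss_mean.
by apply: le_Rintegral => //; [exact: ihg|exact: ig].
Qed.

Lemma is_derive_stein_sol (x : R) : is_derive x 1 stein_sol (stein_sol' x).
Proof.
have dA : is_derive x 1 A (h x * gauss_pdf x).
  by apply: is_derive_Rintegral_Ny; [exact: integrable_gauss_mean|exact: chg].
have dG := is_derive_gauss_cdf x; have dp := is_derive_gauss_pdf x.
have p0 : gauss_pdf x != 0 by rewrite gt_eqF ?gauss_pdf_gt0.
have dV := is_deriveV p0.
rewrite /stein_sol; apply: is_derive_eq.
by rewrite /stein_sol' /stein_sol /GRing.scale /=; field.
Qed.

(* With [a], [b] the two halves of the mean of [h] cut at [x], the quantity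
   [gauss_pdf x * (gauss_mean - x * stein_sol x)] is a combination of [a] and
   [b] with coefficients that Mills' inequalities make nonnegative; hence it is
   maximal for [h = 1], where its value is [gauss_pdf x]. *)
Lemma stein_sol'_le1 (x : R) : `|stein_sol' x| <= 1.
Proof.
have p0 := gauss_pdf_gt0 x.
have -> : stein_sol' x = h x - (gauss_mean - x * stein_sol x).
  by rewrite /stein_sol'; ring.
suff /andP[l u] : 0 <= gauss_mean - x * stein_sol x <= 1.
  by rewrite ler_norml; have := h0 x; have := h1 x; lra.
set a := A x; set b := gauss_mean - A x.
have -> : gauss_mean - x * stein_sol x =
    (a * (gauss_pdf x - x * (1 - gauss_cdf x)) +
     b * (gauss_pdf x + x * gauss_cdf x)) / gauss_pdf x.
  rewrite /stein_sol /a /b; field; exact: lt0r_neq0.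
have m1 : 0 <= gauss_pdf x - x * (1 - gauss_cdf x) by rewrite subr_ge0 mills.
have m2 : 0 <= gauss_pdf x + x * gauss_cdf x.
  by have := millsN x; rewrite mulNr -subr_ge0 opprK.
rewrite divr_ge0 ?(ltW p0)//=; last first.
  by rewrite addr_ge0// mulr_ge0// ?A_ge0 ?tail_ge0.
rewrite ler_pdivrMr// mul1r.
apply: (@le_trans _ _ (gauss_cdf x * (gauss_pdf x - x * (1 - gauss_cdf x)) +
     (1 - gauss_cdf x) * (gauss_pdf x + x * gauss_cdf x))).
  by rewrite lerD// ler_wpM2r// ?A_le ?tail_le.
by rewrite le_eqVlt; apply/orP; left; apply/eqP; ring.
Qed.

End SteinSolution.

(** * C^{1,1} regularity of Stein solutions, and ramp functions *)

Section SteinRegularity.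
Context {R : realType}.

(** The bounds are local because the trace stays in [[-N, N]]; no global estimate of the Stein
    solution is then required. The Taylor estimate is the form that [flowd_comp] consumes. *)
Definition C11_on (B : R) (f f' : R -> R) :=
  [/\ measurable_fun setT f, measurable_fun setT f' & exists K, forall x y,
      `|x| <= B -> `|y| <= B -> [/\ `|f x| <= K, `|f' x| <= K &
      `|f y - f x - f' x * (y - x)| <= K * (y - x) ^+ 2]].

(** Absolute values free the mean value theorem from the order of [x] and [y]; the last bound keeps
    [c] in any interval [[-B, B]] containing both. *)
Lemma MVT_between (f f' : R -> R) (x y : R) :
  (forall t : R, is_derive t 1 f (f' t)) ->
  exists c, [/\ f y - f x = f' c * (y - x), `|c - x| <= `|y - x| &
                `|c| <= Num.max `|x| `|y|].
Proof.
move=> df.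
have cf : continuous f.
  by move=> t; apply: differentiable_continuous; exact/derivable1_diffP.
have bt (u v c : R) : u < v -> c \in `]u, v[ ->
    [/\ `|c - u| <= `|v - u|, `|c - v| <= `|u - v| &
        `|c| <= Num.max `|u| `|v|].
  move=> uv; rewrite in_itv/= => /andP[uc cv]; split.
  - by rewrite !ger0_norm; lra.
  - by rewrite !ler0_norm; lra.
  rewrite le_max; have [c0|c0] := leP 0 c.
    by apply/orP; right; rewrite !ger0_norm; lra.
  by apply/orP; left; rewrite !ler0_norm; lra.
have cfw (A : set R) : {within A, continuous f} by exact: continuous_subspaceT.
have [xy|yx|->] := ltgtP x y.
- have [c /(bt _ _ _ xy)[? ? ?] e] := MVT xy (fun t _ => df t) (cfw _).
  by exists c.
- have [c /(bt _ _ _ yx)[? ? ?] e] := MVT yx (fun t _ => df t) (cfw _).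
  exists c; split => //; last by rewrite maxC.
  by rewrite -opprB e; ring.
- by exists y; split; rewrite ?subrr ?mulr0 ?normr0 ?le_max ?lexx.
Qed.

Lemma C11_on_derive (B : R) (f f' : R -> R) (K : R) :
  (forall x : R, is_derive x 1 f (f' x)) -> measurable_fun setT f' ->
  (forall x, `|x| <= B -> `|f x| <= K) ->
  (forall x, `|x| <= B -> `|f' x| <= K) ->
  (forall x y, `|x| <= B -> `|y| <= B -> `|f' y - f' x| <= K * `|y - x|) ->
  C11_on B f f'.
Proof.
move=> df mf' fK f'K lf'; split => //.
  apply: continuous_measurable_fun => t.
  by apply: differentiable_continuous; exact/derivable1_diffP.
exists K => x y xB yB; split; [exact: fK|exact: f'K|].
have [c [-> cx cB]] := MVT_between f f' x y df.
rewrite -mulrBl normrM -real_normK ?num_real// expr2 mulrA ler_wpM2r//.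
have K0 : 0 <= K by apply: le_trans (fK _ xB).
rewrite (le_trans (lf' _ _ xB _))//; last by rewrite ler_wpM2l.
by rewrite (le_trans cB)// ge_max xB.
Qed.

Lemma C11_on_id (B : R) : C11_on B id (cst 1).
Proof.
apply: (@C11_on_derive _ _ _ (Num.max B 1)) => //.
- by move=> x xB; rewrite le_max xB.
- by move=> x _; rewrite le_max normr1 lexx orbT.
- move=> x y _ _; rewrite /cst subrr normr0 mulr_ge0//.
  by rewrite le_max ler01 orbT.
Qed.

(** Everything follows from [|f'| <= 1]: the solution [f] is 1-Lipschitz, hence at most [|f 0| + B]
    on [[-B, B]], and then [x * f x + h x] has Lipschitz constant [|f 0| + 2 * B + L] there. *)
Lemma C11_on_stein_sol (B L : R) (h : R -> R) : continuous h ->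
  (forall x, 0 <= h x) -> (forall x, h x <= 1) ->
  (forall x y, `|h x - h y| <= L * `|x - y|) ->
  C11_on B (stein_sol h) (stein_sol' h).
Proof.
move=> ch h0 h1 hL.
have df := is_derive_stein_sol h ch h0 h1.
have d1 := stein_sol'_le1 h ch h0 h1.
have cf : continuous (stein_sol h).
  by move=> t; apply: differentiable_continuous; exact/derivable1_diffP.
have f1 x y : `|stein_sol h y - stein_sol h x| <= `|y - x|.
  have [c [-> _ _]] := MVT_between _ _ x y df.
  by rewrite normrM ler_piMl.
have [B0|B0] := ltP B 0.
  split.
  - exact: continuous_measurable_fun.
  - apply: continuous_measurable_fun => t; apply: cvgB; last exact: cvg_cst.
    apply: cvgD; last exact: ch.
    by apply: cvgM; [exact: cvg_id|exact: cf].
  by exists 0 => x y xB; have := le_lt_trans xB B0; rewrite ltNge normr_ge0.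
have L0 : 0 <= L.
  by have := hL 1 0; rewrite subr0 normr1 mulr1; apply: le_trans.
have fB x : `|x| <= B -> `|stein_sol h x| <= `|stein_sol h 0| + B.
  move=> xB; rewrite -[stein_sol h x](subrK (stein_sol h 0)).
  rewrite (le_trans (ler_normD _ _))// addrC lerD2l.
  by rewrite (le_trans (f1 _ _))// subr0.
have f00 : 0 <= `|stein_sol h 0| by [].
apply: (@C11_on_derive _ _ _ (`|stein_sol h 0| + 2 * B + L + 1)) => //.
- apply: continuous_measurable_fun => t; apply: cvgB; last exact: cvg_cst.
  apply: cvgD; last exact: ch.
  by apply: cvgM; [exact: cvg_id|exact: cf].
- by move=> x /fB xB; lra.
- by move=> x _; have := d1 x; lra.
move=> x y xB yB; rewrite /stein_sol'.
have -> : y * stein_sol h y + h y - gauss_mean h -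
   (x * stein_sol h x + h x - gauss_mean h) =
   (y - x) * stein_sol h y + x * (stein_sol h y - stein_sol h x) + (h y - h x).
  by ring.
rewrite (le_trans (ler_normD _ _))//.
have t1 : `|h y - h x| <= L * `|y - x| by [].
have t2 : `|(y - x) * stein_sol h y + x * (stein_sol h y - stein_sol h x)| <=
    (`|stein_sol h 0| + B) * `|y - x| + B * `|y - x|.
  rewrite (le_trans (ler_normD _ _))// (normrM (y - x)) (normrM x) lerD//.
    by rewrite [leLHS]mulrC ler_wpM2r// fB.
  by rewrite ler_pM.
have := normr_ge0 (y - x).
lra.
Qed.

Definition ramp (y e x : R) : R := Num.max 0 (Num.min 1 ((y + e - x) / e)).

Lemma ramp_ge0 y e x : 0 <= ramp y e x.
Proof. by rewrite le_max lexx. Qed.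

Lemma ramp_le1 y e x : ramp y e x <= 1.
Proof. by rewrite ge_max ler01 ge_min lexx. Qed.

Lemma ramp_eq1 y e x : 0 < e -> x <= y -> ramp y e x = 1.
Proof.
move=> e0 xy; rewrite /ramp min_l ?max_r// ler_pdivlMr// mul1r; lra.
Qed.

Lemma ramp_eq0 y e x : 0 < e -> y + e <= x -> ramp y e x = 0.
Proof.
move=> e0 xy; rewrite /ramp max_l// ge_min; apply/orP; right.
rewrite ler_pdivrMr// mul0r; lra.
Qed.

Lemma ramp_lipschitz y e x z : 0 < e ->
  `|ramp y e x - ramp y e z| <= e^-1 * `|x - z|.
Proof.
move=> e0; rewrite -(gtr0_norm (_ : 0 < e^-1)) ?invr_gt0// -normrM.
rewrite mulrC -[leRHS]normrN -mulNr.
have -> : - (x - z) / e = (y + e - x) / e - (y + e - z) / e by ring.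
rewrite /ramp; set a := _ / e; set b := _ / e.
(* Clamping to [[0, 1]] is 1-Lipschitz; for each position of [a] and [b] relative to 0 and 1 this is
   linear arithmetic. *)
have [a0|a0] := leP 0 a; have [b0|b0] := leP 0 b;
have [a1|a1] := leP 1 a; have [b1|b1] := leP 1 b;
rewrite ?(max_r a0) ?(max_r b0) ?(max_l (ltW a0)) ?(max_l (ltW b0))
  ?(max_r ler01) ?ler_norml; have := ler_norm (a - b);
  have := ler_norm (b - a); rewrite (distrC b a); lra.
Qed.

Lemma continuous_ramp y e : continuous (ramp y e).
Proof.
move=> x; apply: (@continuous_max R R (cst 0) _ x); first exact: cvg_cst.
apply: (@continuous_min R R (cst 1) _ x); first exact: cvg_cst.
by apply: cvgMl; apply: cvgB; [exact: cvg_cst|exact: cvg_id].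
Qed.

End SteinRegularity.

(** * From ramps to distribution functions *)

Section Kolmogorov.
Context {R : realType} {d : measure_display} {T : measurableType d}.
Variables (P : probability T R) (W : T -> R).
Hypothesis mW : measurable_fun setT W.

Lemma integrable_bounded (F : T -> R) (K : R) : measurable_fun setT F ->
  (forall w, `|F w| <= K) -> P.-integrable setT (EFin \o F).
Proof.
move=> mF FK; apply: measurable_bounded_integrable => //.
  by rewrite (le_lt_trans (probability_le1 _ _)) ?ltry.
exists K; split; first exact: num_real.
by move=> M KM w _; exact: le_trans (FK w) (ltW KM).
Qed.

Lemma integrable_ramp (y e : R) :
  P.-integrable setT (EFin \o (fun w => ramp y e (W w))).
Proof.
apply: (integrable_bounded _ 1); last first.
  by move=> w; rewrite ger0_norm ?ramp_ge0 ?ramp_le1.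
exact: (measurableT_comp (continuous_measurable_fun (continuous_ramp y e)) mW).
Qed.

Let measurable_sublevel x : measurable [set w | W w <= x].
Proof.
rewrite (_ : [set w | W w <= x] = setT `&` W @^-1` `]-oo, x]); last first.
  by rewrite setTI; apply/seteqP; split => w /=; rewrite in_itv.
exact: mW.
Qed.

Let Rintegral_sublevel x :
  \int[P]_w \1_[set w | W w <= x] w = fine (P [set w | W w <= x]).
Proof. by rewrite /Rintegral integral_indic// setIT. Qed.

Let integrable_sublevel x :
  P.-integrable setT (EFin \o (\1_[set w | W w <= x] : T -> R)).
Proof.
apply: (integrable_bounded _ 1); first exact: measurable_indic.
by move=> w; rewrite indicE; case: (_ \in _); rewrite ?normr1 ?normr0.
Qed.

Lemma sublevel_le_ramp (x e : R) : 0 < e ->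
  fine (P [set w | W w <= x]) <= \int[P]_w ramp x e (W w).
Proof.
move=> e0; rewrite -Rintegral_sublevel; apply: le_Rintegral => //.
  exact: integrable_ramp.
move=> w _; rewrite indicE; case: (boolP (w \in _)) => [|_].
  by rewrite inE => /= Wx; rewrite ramp_eq1.
exact: ramp_ge0.
Qed.

Lemma ramp_le_sublevel (x e : R) : 0 < e ->
  \int[P]_w ramp x e (W w) <= fine (P [set w | W w <= x + e]).
Proof.
move=> e0; rewrite -Rintegral_sublevel; apply: le_Rintegral => //.
  exact: integrable_ramp.
move=> w _; rewrite indicE; case: (boolP (w \in _)) => [_|].
  exact: ramp_le1.
by rewrite notin_setE /= => /negP; rewrite -ltNge => /ltW xW; rewrite ramp_eq0.
Qed.

Lemma gauss_mean_ramp (x e : R) : 0 < e ->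
  gauss_cdf x <= gauss_mean (ramp x e) <= gauss_cdf (x + e).
Proof.
move=> e0.
have cdfE y : gauss_cdf y =
    \int[lebesgue_measure]_t (@gauss_pdf R \_ `]-oo, y]) t.
  by rewrite /gauss_cdf Rintegral_mkcond.
rewrite !cdfE /gauss_mean.
have i1 := integrable_gauss_mean (ramp x e) (continuous_ramp x e)
  (ramp_ge0 x e) (ramp_le1 x e).
have ip y : lebesgue_measure.-integrable setT
  (EFin \o (@gauss_pdf R \_ `]-oo, y])).
  rewrite -restrict_EFin.
  have igy : lebesgue_measure.-integrable `]-oo, y] (EFin \o @gauss_pdf R).
    by apply: (integrableS _ _ _ integrable_gauss_pdf).
  by apply: (@integrable_mkcond _ _ R lebesgue_measure `]-oo, y] _ _).1 igy.
apply/andP; split; apply: le_Rintegral => // t _.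
- rewrite patchE; case: (boolP (t \in _)) => [|_].
    by rewrite inE /= in_itv /= => tx; rewrite ramp_eq1// mul1r.
  by rewrite mulr_ge0 ?ramp_ge0// ltW ?gauss_pdf_gt0.
- rewrite patchE; case: (boolP (t \in _)) => [_|].
    by rewrite ler_piMl ?ramp_le1// ltW ?gauss_pdf_gt0.
  rewrite notin_setE /= in_itv /= => /negP; rewrite -ltNge => /ltW xt.
  by rewrite ramp_eq0// mul0r.
Qed.

(** The ramp descending on [[x, x + e]] bounds the probability from above, the one descending on
    [[x - e, x]] from below. As [delta] is the same for all [e], the only loss is the increment of
    [gauss_cdf] over length [e], at most [e]. *)
Lemma kolmogorov_of_ramp (delta : R) :
  (forall y e, 0 < e ->
    `|\int[P]_w ramp y e (W w) - gauss_mean (ramp y e)| <= delta) ->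
  forall x, `|fine (P [set w | W w <= x]) - gauss_cdf x| <= delta.
Proof.
move=> H x; apply/ler_addgt0Pr => e e0.
have /andP[_ u1] := gauss_mean_ramp x e e0.
have /andP[u2 _] := gauss_mean_ramp (x - e) e e0.
have s1 := sublevel_le_ramp x e e0.
have := ramp_le_sublevel (x - e) e e0; rewrite subrK => s2.
have c1 := gauss_cdfD_le x e (ltW e0).
have := gauss_cdfD_le (x - e) e (ltW e0); rewrite subrK => c2.
have := H x e e0; have := H (x - e) e e0.
rewrite !ler_norml => /andP[? ?] /andP[? ?]; apply/andP; split; lra.
Qed.

End Kolmogorov.
(** * The compact symplectic group and its Haar integral *)

Section Cayley.
Local Open Scope sesquilinear_scope.
Context {C : numClosedFieldType} {n : nat}.
Notation J := (symplectic_form C n).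
Implicit Types B X : 'M[C]_(n + n).

Lemma trmx_symplectic_form : J^T = - J.
Proof.
by rewrite /symplectic_form tr_block_mx opp_block_mx !trmx0 raddfN /=
  trmx1 opprK !oppr0.
Qed.

Lemma mulmx_symplectic_form : J *m J = - 1%:M.
Proof.
rewrite /symplectic_form mulmx_block !mul0mx !mulmx0 mulmx1 mul1mx.
by rewrite !add0r !addr0 scalar_mx_block opp_block_mx !oppr0.
Qed.

(* As [J^-1 = - J], this is the usual condition [X^T J + J X = 0]. *)
Definition in_sp X := J *m X^T *m J = X.

Definition in_usp B := B^t* = - B /\ in_sp B.

Lemma in_sp_trmx_mul X : in_sp X -> X^T *m J = - (J *m X).
Proof.
move=> XE; rewrite -[in RHS]XE !mulmxA mulmx_symplectic_form.
by rewrite !mulNmx mul1mx opprK.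
Qed.

Lemma rV_norm_eq0 (m : nat) (v : 'rV[C]_m) : v *m v^t* = 0 -> v = 0.
Proof.
by move=> /rowP /(_ 0); rewrite -dotmxE mxE => /eqP; rewrite dnorm_eq0 => /eqP.
Qed.

(** A skew-Hermitian matrix does not have the eigenvalue 1: [v = v *m B] makes the squared norm of
    [v] equal to its own opposite. *)
Lemma unitmx1B B : B^t* = - B -> 1%:M - B \in unitmx.
Proof.
move=> Bh; rewrite -row_free_unit -kermx_eq0; apply/eqP/row_matrixP => i.
rewrite row0; set v := row i _.
have : v *m (1%:M - B) = 0 by rewrite /v -row_mul mulmx_ker row0.
rewrite mulmxBr mulmx1 => /eqP; rewrite subr_eq0 => /eqP vB.
apply: rV_norm_eq0.
have : v *m v^t* = - (v *m v^t*).
  by rewrite {2}vB trmx_mul map_mxM Bh mulNmx mulmxN mulmxA -vB.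
move/eqP; rewrite -addr_eq0 -mulr2n -scaler_nat scaler_eq0 pnatr_eq0 /=.
by move/eqP.
Qed.

(* A rational substitute for the exponential: [cayley (t / 2 *: A)] is a curve
   in the group with velocity [A] at [t = 0]. *)
Definition cayley B := (1%:M + B) *m invmx (1%:M - B).

Lemma cayley_mul B : B^t* = - B -> cayley B *m (1%:M - B) = 1%:M + B.
Proof. by move=> Bh; rewrite mulmxKV//; exact: unitmx1B. Qed.

Lemma mulmx_1D1B B : (1%:M + B) *m (1%:M - B) = (1%:M - B) *m (1%:M + B).
Proof.
rewrite mulmxDl mulmxBl !mul1mx !mulmxBr !mulmxDr !mulmx1.
by rewrite opprD !addrA subrK addrK.
Qed.

Lemma mul_cayley B : B^t* = - B -> (1%:M - B) *m cayley B = 1%:M + B.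
Proof.
move=> Bh; rewrite mulmxA -mulmx_1D1B mulmxK//; exact: unitmx1B.
Qed.

Lemma cayley_uspmx B : in_usp B -> cayley B \in uspmx C n.
Proof.
move=> [Bh Bs]; have BU := unitmx1B _ Bh; apply/andP; split.
  apply/unitarymxP.
  have hm : (1%:M - B)^t* = 1%:M + B.
    by rewrite [(_ - _)^T]raddfB /= map_mxB trmx1 map_mx1 Bh opprK.
  have hp : (1%:M + B)^t* = 1%:M - B.
    by rewrite [(_ + _)^T]raddfD /= map_mxD trmx1 map_mx1 Bh.
  have hC : (cayley B)^t* *m (1%:M + B) = 1%:M - B.
    have := congr1 (fun M => M^t*) (mul_cayley _ Bh).
    by rewrite trmx_mul map_mxM hm hp.
  have e : 1%:M - B = (cayley B)^t* *m cayley B *m (1%:M - B).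
    by rewrite -mulmxA cayley_mul.
  apply: mulmx1C; apply: (can_inj (mulmxK BU)).
  by rewrite -e mul1mx.
(* Moving a transposed factor across [J] changes the sign of [B], so [1 + B] and [1 - B] are
   exchanged and the two halves of the Cayley transform cancel. *)
have BJ : B^T *m J = - (J *m B) by exact: in_sp_trmx_mul.
have J1 : (1%:M + B)^T *m J = J *m (1%:M - B).
  by rewrite raddfD /= trmx1 mulmxDl mul1mx BJ mulmxBr mulmx1.
have J2 : (1%:M - B)^T *m J = J *m (1%:M + B).
  by rewrite raddfB /= trmx1 mulmxBl mul1mx BJ opprK mulmxDr mulmx1.
apply/eqP; rewrite {1}/cayley trmx_mul -(mulmxA _ _ J) J1 -!mulmxA.
by rewrite mul_cayley// -J2 mulmxA -trmx_mul mulmxV// trmx1 mul1mx.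
Qed.

(** An exact second-order remainder, obtained by applying [cayley B - 1 = B (1 + cayley B)] twice.
    For [B] of order [t] it is quadratic in [t], and the remaining factor is bounded because
    [cayley B] is unitary when [B] lies in the Lie algebra. *)
Lemma cayley_expansion B : B^t* = - B ->
  cayley B - 1%:M - 2%:R *: B = B *m B *m (1%:M + cayley B).
Proof.
move=> Bh; have h1 : cayley B - 1%:M = B *m (1%:M + cayley B).
  have := mul_cayley _ Bh; rewrite mulmxBl mul1mx mulmxDr mulmx1 => /eqP.
  by rewrite subr_eq -addrA addrC => /eqP e; apply/eqP; rewrite subr_eq;
    apply/eqP.
rewrite -mulmxA -h1 [X in X - _ = _]h1 scaler_nat mulr2n mulmxDr mulmxBr mulmx1.
by rewrite opprD addrA [B + _]addrC addrK.
Qed.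

Lemma unitarymx_entry_le1 (m : nat) (U : 'M[C]_m) (i j : 'I_m) :
  U \is unitarymx -> `|U i j| <= 1.
Proof.
move=> /unitarymxP /matrixP /(_ i i); rewrite !mxE eqxx /= => e.
rewrite -(@expr_le1 _ 2)// -[leRHS]e (bigD1 j)//= !mxE -normCK lerDl.
by apply: sumr_ge0 => k _; rewrite !mxE -normCK exprn_ge0.
Qed.

End Cayley.

(** * Continuity and measurability on the group, and invariance of the integral *)

Section UspTopology.
Context {C : numClosedFieldType} {n : nat}.
Notation G := (USp C n).

Lemma continuous_usp_val : continuous (@usp_val C n : G -> 'M[C]_(n + n)).
Proof. exact: initial_continuous. Qed.

Lemma continuous_usp_entry i j : continuous (fun g : G => usp_val g i j).
Proof.
move=> g; apply: (@continuous_comp _ _ _ _ (fun M : 'M[C]_(n + n) => M i j));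
  [exact: continuous_usp_val|exact: coord_continuous].
Qed.

Lemma continuous_usp_mul (h : G) : continuous (fun g : G => (h * g)%g).
Proof.
apply: continuous_comp_initial => g A /= [B nB BA].
suff : nbhs g [set g0 : G | forall i j, B i j (usp_val (h * g0)%g i j)].
  by apply: filterS => g0 Bg0; exact: BA.
apply: (@filter_forall G _
  (fun i g0 => forall j, B i j (usp_val (h * g0)%g i j)) (nbhs g) _) => i.
apply: (@filter_forall G _ (fun j g0 => B i j (usp_val (h * g0)%g i j)) (nbhs g) _) => j.
have e (g0 : G) : usp_val (h * g0)%g i j =
  \sum_k usp_val h i k * usp_val g0 k j.
  by rewrite mxE.
have : (fun g0 : G => \sum_k usp_val h i k * usp_val g0 k j) @ g -->
    \sum_k usp_val h i k * usp_val g k j.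
  apply: (@cvg_big _ _ _ _ _ _ _ _ _ _ _ (nbhs_filter g)) => [|k _];
    first exact: add_continuous.
  by apply: cvgMr; exact: (@continuous_usp_entry k j g).
rewrite -e => /(_ _ (nB i j)); apply: (@filterS _ _ (nbhs_filter g)) => g0 /=.
by rewrite -e.
Qed.

End UspTopology.

Section HaarIntegral.
Context {R : realType} {n : nat}.
Notation G := (USp R[i] n).
Notation GB := (USpBorel R[i] n).

Lemma Re_lipschitz (z w : R[i]) : `|complex.Re z - complex.Re w|%:C%C <=
  `|z - w|.
Proof.
rewrite -[X in X%:C%C](_ : `|complex.Re (z - w)| = _);
  last by case: z w => [a b] [c d].
exact: normc_ge_Re.
Qed.

Lemma Im_lipschitz (z w : R[i]) : `|complex.Im z - complex.Im w|%:C%C <=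
  `|z - w|.
Proof.
rewrite -[X in X%:C%C](_ : `|complex.Im (z - w)| = _);
  last by case: z w => [a b] [c d].
by rewrite normc_def lecR -sqrtr_sqr ler_wsqrtr// lerDr sqr_ge0.
Qed.

Lemma continuous_usp_Re i j : continuous (fun g : G => complex.Re (usp_val g i j)).
Proof.
move=> g A /nbhs_ballP[e /= e0 eA].
have : nbhs g [set g' : G | `|usp_val g i j - usp_val g' i j| < e%:C%C].
  have /cvgrPdist_lt := @continuous_usp_entry R[i] n i j g; apply.
  by rewrite -[0]/(0%:C)%C ltcR.
apply: filterS => g' /= zw; apply: eA => /=.
by rewrite /ball /= -ltcR (le_lt_trans (Re_lipschitz _ _)).
Qed.

Lemma continuous_usp_Im i j : continuous (fun g : G => complex.Im (usp_val g i j)).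
Proof.
move=> g A /nbhs_ballP[e /= e0 eA].
have : nbhs g [set g' : G | `|usp_val g i j - usp_val g' i j| < e%:C%C].
  have /cvgrPdist_lt := @continuous_usp_entry R[i] n i j g; apply.
  by rewrite -[0]/(0%:C)%C ltcR.
apply: filterS => g' /= zw; apply: eA => /=.
by rewrite /ball /= -ltcR (le_lt_trans (Im_lipschitz _ _)).
Qed.

Lemma measurable_continuous_usp (f : G -> R) : continuous f ->
  measurable_fun setT (f : GB -> R).
Proof.
move=> cf; apply: (measurability _ (RGenOpens.measurableE R)).
move=> _ [_ [x [y ->]] <-]; rewrite setTI.
apply: sub_sigma_algebra.
have := (continuousP _).1 cf; apply; exact: interval_open.
Qed.

End HaarIntegral.
Section HaarInvariance.
Context {R : realType} {n : nat}.
Notation G := (USp R[i] n).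
Notation GB := (USpBorel R[i] n).
Context {P : probability GB R}.
Hypothesis hP : is_haar P.

Lemma measurable_usp_mul (h : G) :
  measurable_fun setT ((fun g : G => (h * g)%g) : GB -> GB).
Proof.
apply: (@measurability _ _ GB GB setT _ (@open G)) => // _ [A oA <-];
  rewrite setTI.
by apply: sub_sigma_algebra; move/continuousP : (continuous_usp_mul h); exact.
Qed.

Lemma haar_integral_mul (h : G) (F : GB -> R) (K : R) :
  measurable_fun setT F -> (forall g, `|F g| <= K) ->
  \int[P]_g F ((h * (g : G))%g) = \int[P]_g F g.
Proof.
move=> mF FK.
have mphi := measurable_usp_mul h.
set phi := (fun g : G => (h * g)%g) in mphi *.
rewrite /Rintegral; congr fine.
transitivity (\int[pushforward P (phi : GB -> GB)]_g (F g)%:E)%E.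
  rewrite integral_pushforward//.
    exact/measurable_EFinP.
  rewrite preimage_setT.
  apply: (integrable_bounded P (F \o phi) K) => [|g]; last exact: FK.
  exact: measurableT_comp.
apply: eq_measure_integral => A mA _; rewrite /pushforward /=.
(* The preimage of [A] under translation by [h] is the translate of [A] by [h^-1], which is why
   invariance is used at the inverse. *)
rewrite -[RHS](hP (h^-1)%g)//; congr (P _).
apply/seteqP; split => [g /= Ag|_ /= [g Ag <-]].
  by exists (h * g)%g => //; rewrite mulKg.
by rewrite /phi mulVKg.
Qed.

End HaarInvariance.

(** * Bounded measurable complex functions and their means *)

Section Normc.
Context {R : realType}.
Implicit Types z w : R[i].

Lemma normcE z : (normc z)%:C%C = `|z|.
Proof. by rewrite normc_def; case: z. Qed.

Lemma normc_ge0 z : 0 <= normc z.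
Proof. by case: z => a b; exact: sqrtr_ge0. Qed.

Lemma normc_le (z : R[i]) (r : R) : (normc z <= r) = (`|z| <= r%:C%C).
Proof. by rewrite -lecR normcE. Qed.

Lemma normc_triangle z w : normc (z + w) <= normc z + normc w.
Proof. exact: le_normcD. Qed.

Lemma normc_real (r : R) : normc r%:C%C = `|r|.
Proof. by rewrite /= expr0n /= addr0 sqrtr_sqr. Qed.

Lemma Re_le_normc z : `|complex.Re z| <= normc z.
Proof. by case: z => a b /=; rewrite -sqrtr_sqr ler_wsqrtr// lerDl sqr_ge0. Qed.

Lemma Im_le_normc z : `|complex.Im z| <= normc z.
Proof. by case: z => a b /=; rewrite -sqrtr_sqr ler_wsqrtr// lerDr sqr_ge0. Qed.

Lemma normc_sum (I : finType) (F : I -> R[i]) :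
  normc (\sum_i F i) <= \sum_i normc (F i).
Proof.
apply: (big_ind2 (fun z r => normc z <= r)) => //.
  by rewrite -[0]/(0%C) normc0.
move=> z1 r1 z2 r2 h1 h2.
by rewrite (le_trans (normc_triangle _ _))// lerD.
Qed.

End Normc.

Section BoundedMeasurable.
Context {R : realType} {d : measure_display} {T : measurableType d}.
Implicit Types F H : T -> R[i].

(** Complex values are needed because derivatives will be extended to complex directions;
    boundedness makes integrability against a probability automatic. *)
Definition bmeas F := [/\ measurable_fun setT (fun x => complex.Re (F x)),
  measurable_fun setT (fun x => complex.Im (F x)) &
  exists K, forall x, normc (F x) <= K].

Lemma bmeas_cst (c : R[i]) : bmeas (fun=> c).
Proof. by split => //; exists (normc c). Qed.

Lemma bmeasD F H : bmeas F -> bmeas H -> bmeas (fun x => F x + H x).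
Proof.
move=> [r1 i1 [K1 b1]] [r2 i2 [K2 b2]]; split.
- rewrite (_ : (fun x => _) = (fun x => complex.Re (F x) + complex.Re (H x))).
    exact: measurable_funD.
  by apply/funext => x; case: (F x) (H x) => [a b] [c e].
- rewrite (_ : (fun x => _) = (fun x => complex.Im (F x) + complex.Im (H x))).
    exact: measurable_funD.
  by apply/funext => x; case: (F x) (H x) => [a b] [c e].
- by exists (K1 + K2) => x; rewrite (le_trans (normc_triangle _ _))// lerD.
Qed.

Lemma bmeasM F H : bmeas F -> bmeas H -> bmeas (fun x => F x * H x).
Proof.
move=> [r1 i1 [K1 b1]] [r2 i2 [K2 b2]]; split.
- rewrite (_ : (fun x => _) = (fun x => complex.Re (F x) * complex.Re (H x) -
      complex.Im (F x) * complex.Im (H x))).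
    by apply: measurable_funB; exact: measurable_funM.
  by apply/funext => x; case: (F x) (H x) => [a b] [c e].
- rewrite (_ : (fun x => _) = (fun x => complex.Re (F x) * complex.Im (H x) +
      complex.Im (F x) * complex.Re (H x))).
    by apply: measurable_funD; exact: measurable_funM.
  by apply/funext => x; case: (F x) (H x) => [a b] [c e].
- exists (K1 * K2) => x; rewrite normcM; apply: ler_pM => //; exact: normc_ge0.
Qed.

Lemma bmeas_sum (I : Type) (r : seq I) (F : I -> T -> R[i]) :
  (forall i, bmeas (F i)) -> bmeas (fun x => \sum_(i <- r) F i x).
Proof.
move=> bF; elim: r => [|i r IH].
  by under eq_fun do rewrite big_nil; exact: bmeas_cst.
by under eq_fun do rewrite big_cons; exact: bmeasD.
Qed.

Lemma bmeas_real (u : T -> R) (K : R) : measurable_fun setT u ->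
  (forall x, `|u x| <= K) -> bmeas (fun x => (u x)%:C%C).
Proof.
move=> mu uK; split; [exact: mu|exact: measurable_cst|].
by exists K => x; rewrite normc_real.
Qed.

Context {P : probability T R}.

Definition cmean F : R[i] :=
  ((\int[P]_x complex.Re (F x)) +i* (\int[P]_x complex.Im (F x)))%C.

Lemma bmeas_integrable_Re F : bmeas F ->
  P.-integrable setT (EFin \o (fun x => complex.Re (F x))).
Proof.
move=> [mr _ [K bK]]; apply: (integrable_bounded P _ K) => // x.
exact: le_trans (Re_le_normc _) (bK x).
Qed.

Lemma bmeas_integrable_Im F : bmeas F ->
  P.-integrable setT (EFin \o (fun x => complex.Im (F x))).
Proof.
move=> [_ mi [K bK]]; apply: (integrable_bounded P _ K) => // x.
exact: le_trans (Im_le_normc _) (bK x).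
Qed.

Lemma eq_cmean F H : F =1 H -> cmean F = cmean H.
Proof. by move=> FH; congr cmean; exact/funext. Qed.

Lemma cmeanD F H : bmeas F -> bmeas H ->
  cmean (fun x => F x + H x) = cmean F + cmean H.
Proof.
move=> bF bH; rewrite /cmean.
have [rF iF] := (bmeas_integrable_Re _ bF, bmeas_integrable_Im _ bF).
have [rH iH] := (bmeas_integrable_Re _ bH, bmeas_integrable_Im _ bH).
rewrite -[RHS]/(Complex _ _) -!RintegralD//.
by congr Complex; apply: eq_Rintegral => x _; case: (F x) (H x) => [a b] [c e].
Qed.

Lemma cmeanZ (c : R[i]) F : bmeas F -> cmean (fun x => c * F x) = c * cmean F.
Proof.
move=> bF; rewrite /cmean.
have [rF iF] := (bmeas_integrable_Re _ bF, bmeas_integrable_Im _ bF).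
case: c => a b; rewrite -[RHS]/(Complex _ _) -!RintegralZl//.
have iZ (k : R) (u : T -> R) : P.-integrable setT (EFin \o u) ->
    P.-integrable setT (EFin \o (fun x => k * u x)).
  exact: (integrableZl measurableT k).
rewrite -RintegralB -?RintegralD//; try exact: iZ.
by congr Complex; apply: eq_Rintegral => x _; case: (F x).
Qed.

Lemma cmean_sum (I : Type) (r : seq I) (F : I -> T -> R[i]) :
  (forall i, bmeas (F i)) ->
  cmean (fun x => \sum_(i <- r) F i x) = \sum_(i <- r) cmean (F i).
Proof.
move=> bF; elim: r => [|i r IH].
  rewrite big_nil (eq_cmean _ (fun=> 0)) => [|x]; last by rewrite big_nil.
  by rewrite /cmean /= Rintegral_cst// mul0r.
rewrite big_cons (eq_cmean _ (fun x => F i x + \sum_(j <- r) F j x)).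
  by rewrite cmeanD ?IH//; exact: bmeas_sum.
by move=> x; rewrite big_cons.
Qed.

Lemma cmean_real (u : T -> R) :
  cmean (fun x => (u x)%:C%C) = (\int[P]_x u x)%:C%C.
Proof. by rewrite /cmean /= Rintegral_cst// mul0r. Qed.

End BoundedMeasurable.
(** * Derivatives along measure-preserving flows *)

Section FlowDerivative.
Context {R : realType} {d : measure_display} {T : measurableType d}.
Variable phi : R -> T -> T.
Implicit Types F H : T -> R[i].

(* [F'] is the derivative of [F] along [phi] at [t = 0]. The quadratic error,
   uniform in the point, dispenses with differentiation under the integral. *)
Definition flowd F F' := [/\ bmeas F, bmeas F' & exists K, forall t x,
  0 <= t <= 1 -> normc (F (phi t x) - F x - t%:C%C * F' x) <= K * t ^+ 2].

Lemma eq_flowd F F' H H' : F =1 H -> F' =1 H' -> flowd F F' -> flowd H H'.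
Proof. by move=> /funext-> /funext->. Qed.

Lemma flowd_cst (c : R[i]) : flowd (fun=> c) (fun=> 0).
Proof.
split; [exact: bmeas_cst|exact: bmeas_cst|exists 0 => t x _].
by rewrite subrr mulr0 subr0 -[0]/(0%C) normc0 mul0r.
Qed.

Lemma flowdD F F' H H' : flowd F F' -> flowd H H' ->
  flowd (fun x => F x + H x) (fun x => F' x + H' x).
Proof.
move=> [bF bF' [K1 dF]] [bH bH' [K2 dH]]; split; [exact: bmeasD|exact: bmeasD|].
exists (K1 + K2) => t x t01; rewrite [leRHS]mulrDl.
apply: le_trans (lerD (dF t x t01) (dH t x t01)).
apply: le_trans _ (normc_triangle _ _).
by rewrite le_eqVlt; apply/orP; left; apply/eqP; congr normc; ring.
Qed.

(** Every [M] above [L] serves for all three bounds, so two functions can share one constant in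
    [flowdM]. *)
Lemma flowd_bound F F' : flowd F F' -> exists2 L, 0 <= L &
  forall M, L <= M -> forall x, [/\ normc (F x) <= M, normc (F' x) <= M &
    forall t, 0 <= t <= 1 -> normc (F (phi t x) - F x - t%:C%C * F' x) <=
      M * t ^+ 2].
Proof.
move=> [[_ _ [K1 b1]] [_ _ [K2 b2]] [K3 b3]].
exists (`|K1| + `|K2| + `|K3|); first by rewrite !addr_ge0.
have := (ler_norm K1, ler_norm K2, ler_norm K3).
move=> [[k1 k2] k3] M LM x.
have [[a1 a2] a3] := (normr_ge0 K1, normr_ge0 K2, normr_ge0 K3).
split.
- by apply: le_trans (b1 x) _; lra.
- by apply: le_trans (b2 x) _; lra.
- move=> t t01; apply: le_trans (b3 t x t01) _.
  by rewrite ler_wpM2r ?sqr_ge0//; lra.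
Qed.

Lemma flowdM F F' H H' : flowd F F' -> flowd H H' ->
  flowd (fun x => F x * H x) (fun x => F' x * H x + F x * H' x).
Proof.
move=> dF dH; have [bF bF' _] := dF; have [bH bH' _] := dH.
split; [exact: bmeasM|by apply: bmeasD; exact: bmeasM|].
have [L1 L10 {}dF] := flowd_bound _ _ dF; have [L2 L20 {}dH] :=
  flowd_bound _ _ dH.
set L := L1 + L2; have L0 : 0 <= L by rewrite addr_ge0.
(* With remainders [r] and [s] of the two factors, the error of the product is a sum of six terms,
   each at most [L * L * t ^+ 2] because [t <= 1]. *)
exists (6 * (L * L)) => t x t01.
have L1L : L1 <= L by rewrite lerDl.
have [F1 F2 F3] := dF L L1L x.
have L2L : L2 <= L by rewrite lerDr.
have [H1 H2 H3] := dH L L2L x.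
have {}F3 := F3 t t01; have {}H3 := H3 t t01; move/andP: t01 => [t0 t1].
set r := F (phi t x) - F x - _ in F3.
set s := H (phi t x) - H x - _ in H3.
have -> : F (phi t x) * H (phi t x) - F x * H x -
    t%:C%C * (F' x * H x + F x * H' x) =
    F x * s + r * H x + (t%:C%C * t%:C%C) * (F' x * H' x) + t%:C%C * (r * H' x)
      +
    t%:C%C * (F' x * s) + r * s.
  by rewrite /r /s; ring.
have nt : normc t%:C%C = t by rewrite normc_real ger0_norm.
have tt : t * t = t ^+ 2 by rewrite expr2.
have t20 : 0 <= t ^+ 2 by exact: sqr_ge0.
have t21 : t ^+ 2 <= 1 by rewrite expr_le1.
have p (a b : R[i]) (u v : R) : normc a <= u -> normc b <= v ->
    normc (a * b) <= u * v.
  by move=> au bv; rewrite normcM ler_pM// normc_ge0.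
have P1 := p _ _ _ _ F1 H3; have P2 := p _ _ _ _ F3 H1.
have P3 := p _ _ _ _ F2 H2; have P4 := p _ _ _ _ F3 H2.
have P5 := p _ _ _ _ F2 H3; have P6 := p _ _ _ _ F3 H3.
have ttc : normc (t%:C%C * t%:C%C) <= t ^+ 2 by rewrite normcM nt tt.
have tc : normc t%:C%C <= 1 by rewrite nt.
have {}P3 := p _ _ _ _ ttc P3; have {}P4 := p _ _ _ _ tc P4.
have {}P5 := p _ _ _ _ tc P5.
have LL : 0 <= L * L by rewrite mulr_ge0.
have LLt : 0 <= L * L * t ^+ 2 * (1 - t ^+ 2) by rewrite !mulr_ge0// subr_ge0.
have q (a b : R[i]) (u v : R) : normc a <= u -> normc b <= v ->
    normc (a + b) <= u + v.
  by move=> au bv; exact: le_trans (normc_triangle _ _) (lerD au bv).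
apply: le_trans (q _ _ _ _ (q _ _ _ _ (q _ _ _ _ (q _ _ _ _ (q _ _ _ _ P1 P2)
  P3) P4) P5) P6) _.
lra.
Qed.

Lemma flowd_sum (I : Type) (r : seq I) (F F' : I -> T -> R[i]) :
  (forall i, flowd (F i) (F' i)) ->
  flowd (fun x => \sum_(i <- r) F i x) (fun x => \sum_(i <- r) F' i x).
Proof.
move=> dF; elim: r => [|i r IH].
  by apply: eq_flowd (flowd_cst 0) => x; rewrite big_nil.
by apply: eq_flowd (flowdD _ _ _ _ (dF i) IH) => x; rewrite big_cons.
Qed.

Lemma flowd_comp (f f' : R -> R) (B : R) (w : T -> R) (w' : T -> R[i]) :
  C11_on B f f' -> (forall x, `|w x| <= B) -> flowd (fun x => (w x)%:C%C) w' ->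
  flowd (fun x => (f (w x))%:C%C) (fun x => (f' (w x))%:C%C * w' x).
Proof.
move=> [mf mf' [K hK]] wB dw; have [[mw _ _] bw' _] := dw.
have fK x : `|f (w x)| <= K by have [] := hK (w x) (w x) (wB x) (wB x).
have f'K x : `|f' (w x)| <= K by have [] := hK (w x) (w x) (wB x) (wB x).
split.
- by apply: (bmeas_real _ K) => //; exact: measurableT_comp mf mw.
- apply: bmeasM => //.
  by apply: (bmeas_real _ K) => //; exact: measurableT_comp mf' mw.
have [L L0 {}dw] := flowd_bound _ _ dw.
(* The first term is the Taylor error of [f], as [w] moves by at most
   [L * t ^+ 2 + L * t <= 2 * L * t]; the second is [f'] times the remainder of [w]. *)
exists (K * (2 * L) ^+ 2 + K * L) => t x t01.
have K0 : 0 <= K by exact: le_trans (fK x).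
have [_ w'L] := dw L (lexx _) x; move=> /(_ t t01).
set r := _ - _ - _ => rL.
have [_ _ hf] := hK (w x) (w (phi t x)) (wB _) (wB _).
have -> : (f (w (phi t x)))%:C%C - (f (w x))%:C%C - t%:C%C *
  ((f' (w x))%:C%C * w' x) =
    (f (w (phi t x)) - f (w x) - f' (w x) * (w (phi t x) - w x))%:C%C +
    (f' (w x))%:C%C * r.
  by rewrite /r !(rmorphB, rmorphM) /=; ring.
apply: le_trans (normc_triangle _ _) _; rewrite mulrDl; apply: lerD.
  rewrite normc_real (le_trans hf)// -mulrA ler_wpM2l//.
  rewrite -real_normK ?num_real// -exprMn ler_pXn2r ?nnegrE//; last first.
    by rewrite !mulr_ge0//; case/andP: t01.
  have -> : `|w (phi t x) - w x| = normc (r + t%:C%C * w' x).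
    by rewrite -normc_real /r subrK rmorphB.
  case/andP: t01 => t0 t1.
  apply: le_trans (normc_triangle _ _) _.
  have wt : normc (t%:C%C * w' x) <= t * L.
    by rewrite normcM normc_real ger0_norm// ler_wpM2l.
  apply: le_trans (lerD rL wt) _.
  have : 0 <= L * t * (1 - t) by rewrite !mulr_ge0// subr_ge0.
  by rewrite expr2; lra.
rewrite normcM normc_real -mulrA ler_pM//; exact: normc_ge0.
Qed.

Context {P : probability T R}.
Hypothesis phiP : forall (t : R) (u : T -> R) (K : R), measurable_fun setT u ->
  (forall x, `|u x| <= K) -> [/\ measurable_fun setT (fun x => u (phi t x)) &
  \int[P]_x u (phi t x) = \int[P]_x u x].

(** In the integrated error bound, invariance cancels [u (phi t x)] against [u x]. What remains is
    [t * |I| <= K * t ^+ 2], so [|I| <= K * t] for all small positive [t]. *)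
Lemma flowd_Rintegral0 (u u' : T -> R) (K : R) :
  measurable_fun setT u -> (forall x, `|u x| <= K) ->
  measurable_fun setT u' -> (forall x, `|u' x| <= K) ->
  (forall t x, 0 <= t <= 1 -> `|u (phi t x) - u x - t * u' x| <= K * t ^+ 2) ->
  \int[P]_x u' x = 0.
Proof.
move=> mu uK mu' u'K dK.
have iu := integrable_bounded P _ _ mu uK; have iu' :=
  integrable_bounded P _ _ mu' u'K.
set I := \int[P]_x u' x.
have H t : 0 < t -> t <= 1 -> `|I| <= K * t.
  move=> t0 t1; have [mp ep] := phiP t _ _ mu uK.
  have ip : P.-integrable setT (EFin \o (fun x => u (phi t x))).
    by apply: (integrable_bounded P _ K).
  have itu : P.-integrable setT (EFin \o (fun x => t * u' x)).
    exact: (integrableZl measurableT t iu').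
  have iB (v w : T -> R) : P.-integrable setT (EFin \o v) ->
      P.-integrable setT (EFin \o w) ->
      P.-integrable setT (EFin \o (fun x => v x - w x)).
    exact: (integrableB measurableT).
  have e : \int[P]_x (u (phi t x) - u x - t * u' x) = - (t * I).
    rewrite RintegralB//; last exact: iB.
    by rewrite RintegralB// ep subrr RintegralZl// sub0r.
  have : `|t * I| <= K * t ^+ 2.
    rewrite -normrN -e.
    apply: le_trans (le_normr_Rintegral _ _) _ => //.
      by apply: (iB) => //; exact: iB.
    have -> : K * t ^+ 2 = \int[P]_x (K * t ^+ 2).
      rewrite Rintegral_cst// -[LHS]mulr1; congr (_ * _).
      by apply: esym; exact: (congr1 fine (probability_setT P)).
    apply: le_Rintegral => //.
    - apply: integrable_norm.
      by apply: (iB) => //; exact: iB.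
    - by apply: (integrable_bounded P _ `|K * t ^+ 2|).
    - by move=> x _; apply: dK; rewrite t1 ltW.
  by rewrite normrM gtr0_norm// expr2 mulrA mulrAC mulrC ler_pM2r.
have [//|I0] := eqVneq I 0.
have {}I0 : 0 < `|I| by rewrite normr_gt0.
have K0 : 0 < K.
  by have := H 1 ltr01 (lexx _); rewrite mulr1; exact: lt_le_trans.
(* A time below 1 for which [|I| <= K * t] would give [2 * (K + |I|) <= K]. *)
have := H (`|I| / (2 * (K + `|I|))).
have KI : 0 < K + `|I| by rewrite addr_gt0.
have a : 0 < `|I| / (2 * (K + `|I|)) by rewrite divr_gt0// mulr_gt0.
move=> /(_ a); rewrite ler_pdivrMr ?mulr_gt0// mul1r.
have -> : `|I| <= 2 * (K + `|I|) by lra.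
move=> /(_ isT); rewrite mulrA ler_pdivlMr ?mulr_gt0//.
rewrite [leRHS]mulrC ler_pM2l//; lra.
Qed.

Lemma flowd_cmean0 F F' : flowd F F' -> cmean (P := P) F' = 0.
Proof.
move=> dF; have [[rF iF _] [rF' iF' _] _] := dF.
have [L L0 {}dF] := flowd_bound _ _ dF.
rewrite -[0]/(Complex 0 0) /cmean; congr Complex.
- apply: (flowd_Rintegral0 (fun x => complex.Re (F x)) _ L) => //.
  + by move=> x; have [+ _ _] := dF L (lexx _) x;
      exact: le_trans (Re_le_normc _).
  + by move=> x; have [_ + _] := dF L (lexx _) x;
      exact: le_trans (Re_le_normc _).
  + move=> t x t01; have [_ _ /(_ t t01)] := dF L (lexx _) x.
    apply: le_trans; apply: le_trans (Re_le_normc _).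
    by case: (F (phi t x)) (F x) (F' x) => [a b] [c e] [p q] /=;
      rewrite mul0r subr0.
- apply: (flowd_Rintegral0 (fun x => complex.Im (F x)) _ L) => //.
  + by move=> x; have [+ _ _] := dF L (lexx _) x;
      exact: le_trans (Im_le_normc _).
  + by move=> x; have [_ + _] := dF L (lexx _) x;
      exact: le_trans (Im_le_normc _).
  + move=> t x t01; have [_ _ /(_ t t01)] := dF L (lexx _) x.
    apply: le_trans; apply: le_trans (Im_le_normc _).
    by case: (F (phi t x)) (F x) (F' x) => [a b] [c e] [p q] /=;
      rewrite mul0r addr0.
Qed.

End FlowDerivative.
(** * Schwinger-Dyson equations for traces *)

Section SymplecticProjection.
Context {F : numClosedFieldType} {n : nat}.
Notation J := (symplectic_form F n).
Notation N := (n + n)%N.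
Implicit Types M U V X : 'M[F]_N.

(** The summand is [U i i * V j j]. With a transposed matrix unit it is [U i j * V i j], which gives
    one trace of a product instead of a product of two. *)
Lemma sum_sandwich_delta U V :
  \sum_i \sum_j (U *m delta_mx i j *m V) i j = \tr U * \tr V.
Proof.
rewrite /mxtrace mulr_suml; apply: eq_bigr => i _.
rewrite mulr_sumr; apply: eq_bigr => j _.
rewrite mxE (bigD1 j)//= big1 ?addr0 => [|k kj].
  rewrite mxE (bigD1 i)//= big1 ?addr0 => [|k ki].
    by rewrite mxE !eqxx mulr1.
  by rewrite mxE (negPf ki) mulr0.
rewrite mxE big1 ?mul0r// => l _.
by rewrite mxE (negPf kj) andbF mulr0.
Qed.

Lemma sum_sandwich_delta_tr U V :
  \sum_i \sum_j (U *m (delta_mx i j)^T *m V) i j = \tr (U^T *m V).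
Proof.
rewrite /mxtrace exchange_big /=; apply: eq_bigr => j _.
rewrite mxE; apply: eq_bigr => i _; rewrite trmx_delta [U^T _ _]mxE.
rewrite mxE (bigD1 i)//= big1 ?addr0 => [|k ki].
  rewrite mxE (bigD1 j)//= big1 ?addr0 => [|k kj].
    by rewrite mxE !eqxx mulr1.
  by rewrite mxE (negPf kj) mulr0.
rewrite mxE big1 ?mul0r// => l _.
by rewrite mxE (negPf ki) andbF mulr0.
Qed.

Lemma mxtrace_delta_mul i j V : \tr (delta_mx i j *m V) = V j i.
Proof.
rewrite /mxtrace (bigD1 i)//= big1 ?addr0 => [|k ki].
  rewrite mxE (bigD1 j)//= big1 ?addr0 => [|k kj].
    by rewrite mxE !eqxx mul1r.
  by rewrite mxE (negPf kj) andbF mul0r.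
by rewrite mxE big1// => l _; rewrite mxE (negPf ki) mul0r.
Qed.

Lemma sum_mxtrace_delta U V :
  \sum_i \sum_j U i j * \tr (delta_mx i j *m V) = \tr (U *m V).
Proof.
rewrite /mxtrace; apply: eq_bigr => i _; rewrite mxE; apply: eq_bigr => j _.
by rewrite -/(mxtrace _) mxtrace_delta_mul.
Qed.

Lemma sum_mxtrace_delta_tr U V :
  \sum_i \sum_j U i j * \tr ((delta_mx i j)^T *m V) = \tr (U^T *m V).
Proof.
rewrite exchange_big /= -[RHS]sum_mxtrace_delta; apply: eq_bigr => i _.
by apply: eq_bigr => j _; rewrite trmx_delta mxE.
Qed.

(* Twice the projection onto the symplectic Lie algebra that is orthogonal for
   the trace form. *)
Definition sp_proj M : 'M[F]_N := M + J *m M^T *m J.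

Lemma in_sp_proj M : in_sp (sp_proj M).
Proof.
rewrite /in_sp /sp_proj linearD /= mulmxDr mulmxDl addrC; congr (_ + _).
rewrite !trmx_mul trmxK trmx_symplectic_form !(mulmxN, mulNmx) opprK.
rewrite !mulmxA mulmx_symplectic_form -!mulmxA mulmx_symplectic_form.
by rewrite mulNmx mul1mx mulmxN mulmx1 opprK.
Qed.

Lemma in_spD X U : in_sp X -> in_sp U -> in_sp (X + U).
Proof. by move=> hX hU; rewrite /in_sp linearD /= mulmxDr mulmxDl hX hU. Qed.

Lemma in_spZ (a : F) X : in_sp X -> in_sp (a *: X).
Proof. by move=> hX; rewrite /in_sp linearZ /= -scalemxAr -scalemxAl hX. Qed.

Lemma mxtrace1 : \tr (1%:M : 'M[F]_N) = N%:R.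
Proof. by rewrite mxtrace_scalar. Qed.

(** The Casimir element, in the normalization of [sp_proj], acts on the defining representation as
    the scalar [N + 1]: [N] comes from the plain matrix units and 1 from the transposed ones, since
    [J^T J = 1]. *)
Lemma sum_sp_proj_mul V :
  \sum_i \sum_j (sp_proj (delta_mx i j) *m V) i j = (N%:R + 1) * \tr V.
Proof.
transitivity (\sum_i \sum_j ((1%:M *m delta_mx i j *m V) i j +
    (J *m (delta_mx i j)^T *m (J *m V)) i j)).
  do 2 (apply: eq_bigr => ? _).
  by rewrite /sp_proj mulmxDl mul1mx mxE !mulmxA.
under eq_bigr do rewrite big_split; rewrite big_split /=.
rewrite sum_sandwich_delta sum_sandwich_delta_tr mxtrace1 mulmxA.
by rewrite trmx_symplectic_form mulNmx mulmx_symplectic_form opprK mul1mx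
  mulrDl mul1r.
Qed.

Lemma sum_mul_sp_proj_mul U V :
  \sum_i \sum_j (U *m sp_proj (delta_mx i j) *m V) i j =
  \tr U * \tr V - \tr (J *m U^T *m J *m V).
Proof.
transitivity (\sum_i \sum_j ((U *m delta_mx i j *m V) i j +
    (U *m J *m (delta_mx i j)^T *m (J *m V)) i j)).
  do 2 (apply: eq_bigr => ? _).
  by rewrite /sp_proj mulmxDr mulmxDl mxE !mulmxA.
under eq_bigr do rewrite big_split; rewrite big_split /=.
rewrite sum_sandwich_delta sum_sandwich_delta_tr trmx_mul trmx_symplectic_form.
by rewrite !mulNmx raddfN /= !mulmxA.
Qed.

Lemma sum_mxtrace_sp_proj U V :
  \sum_i \sum_j U i j * \tr (sp_proj (delta_mx i j) *m V) =
  \tr (U *m V) + \tr (U^T *m J *m V *m J).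
Proof.
transitivity (\sum_i \sum_j (U i j * \tr (delta_mx i j *m V) +
    U i j * \tr ((delta_mx i j)^T *m (J *m V *m J)))).
  do 2 (apply: eq_bigr => ? _).
  rewrite /sp_proj mulmxDl raddfD /= mulrDr; congr (_ + _ * _).
  by rewrite -!mulmxA mxtrace_mulC !mulmxA.
under eq_bigr do rewrite big_split; rewrite big_split /=.
by rewrite sum_mxtrace_delta sum_mxtrace_delta_tr !mulmxA.
Qed.

End SymplecticProjection.

Section ComplexSpan.
Local Open Scope sesquilinear_scope.
Context {F : numClosedFieldType} {n : nat}.
Notation J := (symplectic_form F n).
Notation N := (n + n)%N.

Lemma map_conj_symplectic_form : map_mx Num.conj J = J.
Proof.
by rewrite /symplectic_form map_block_mx !raddf0 raddfN /= map_mx1.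
Qed.

Lemma in_sp_trmxC (X : 'M[F]_N) : in_sp X -> in_sp (X^t*).
Proof.
move=> hX; rewrite /in_sp -{2}hX !trmx_mul !map_mxM trmxK.
rewrite trmx_symplectic_form raddfN /= map_conj_symplectic_form.
by rewrite !(mulNmx, mulmxN) opprK mulmxA map_trmx trmxK.
Qed.

(** The compact Lie algebra is a real form: the symplectic one is stable under conjugate
    transposition, so skew-Hermitian and Hermitian parts stay in it, and the latter is ['i] times a
    skew-Hermitian matrix. *)
Lemma in_sp_decomposition (X : 'M[F]_N) : in_sp X ->
  exists A B, [/\ in_usp A, in_usp B & X = 'i *: B + A].
Proof.
move=> hX; have hXC := in_sp_trmxC _ hX.
have hN : in_sp (- X^t*) by rewrite -scaleN1r; exact: in_spZ.
exists (2^-1 *: (X - X^t*)), (- ('i / 2) *: (X + X^t*)); split.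
- split; last by apply: in_spZ; exact: in_spD.
  rewrite linearZ /= map_mxZ fmorphV rmorph_nat linearB /= map_mxB trmxCK.
  by rewrite -scalerN opprB.
- split; last by apply: in_spZ; exact: in_spD.
  rewrite linearZ /= map_mxZ rmorphN rmorphM fmorphV rmorph_nat /= conjCi.
  rewrite linearD /= map_mxD trmxCK.
  by rewrite -[RHS]scaleNr [X in _ *: X]addrC mulNr.
- rewrite scalerA mulrN mulrA -expr2 sqrCi mulN1r opprK -scalerDr.
  rewrite addrACA subrr addr0 (_ : X + X = 2%:R *: X).
    by rewrite scalerA mulVf ?scale1r// pnatr_eq0.
  by rewrite scaler_nat mulr2n.
Qed.

End ComplexSpan.

(** * Flows on matrix-valued functions and the general Schwinger-Dyson equation *)

Section MatrixFlow.
Context {R : realType} {d : measure_display} {T : measurableType d}.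

Definition mbmeas (m p : nat) (M : T -> 'M[R[i]]_(m, p)) :=
  forall i j, bmeas (fun x => M x i j).

Lemma mbmeas_cst (m p : nat) (M : 'M[R[i]]_(m, p)) : mbmeas _ _ (fun=> M).
Proof. by move=> i j; exact: bmeas_cst. Qed.

Lemma mbmeasD (m p : nat) (M H : T -> 'M[R[i]]_(m, p)) :
  mbmeas _ _ M -> mbmeas _ _ H -> mbmeas _ _ (fun x => M x + H x).
Proof.
move=> bM bH i j.
by under eq_fun do rewrite mxE; exact: bmeasD.
Qed.

Lemma mbmeasM (m p q : nat) (M : T -> 'M[R[i]]_(m, p))
  (H : T -> 'M[R[i]]_(p, q)) :
  mbmeas _ _ M -> mbmeas _ _ H -> mbmeas _ _ (fun x => M x *m H x).
Proof.
move=> bM bH i j.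
under eq_fun do rewrite mxE.
by apply: bmeas_sum => k; exact: bmeasM.
Qed.

Lemma bmeas_mxtrace (m : nat) (M : T -> 'M[R[i]]_m) :
  mbmeas _ _ M -> bmeas (fun x => \tr (M x)).
Proof. by move=> bM; apply: bmeas_sum. Qed.

Context {phi : R -> T -> T}.

Definition mflowd (m p : nat) (M M' : T -> 'M[R[i]]_(m, p)) :=
  forall i j, flowd phi (fun x => M x i j) (fun x => M' x i j).

Lemma mflowdM (m p q : nat) (M M' : T -> 'M[R[i]]_(m, p))
    (H H' : T -> 'M[R[i]]_(p, q)) :
  mflowd _ _ M M' -> mflowd _ _ H H' ->
  mflowd _ _ (fun x => M x *m H x) (fun x => M' x *m H x + M x *m H' x).
Proof.
move=> dM dH i j.
apply: (eq_flowd phi (fun x => \sum_k M x i k * H x k j)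
  (fun x => \sum_k (M' x i k * H x k j + M x i k * H' x k j))).
- by move=> x; rewrite mxE.
- by move=> x; rewrite !mxE big_split.
by apply: flowd_sum => k; exact: flowdM.
Qed.

Lemma flowd_mxtrace (m : nat) (M M' : T -> 'M[R[i]]_m) :
  mflowd _ _ M M' -> flowd phi (fun x => \tr (M x)) (fun x => \tr (M' x)).
Proof. by move=> dM; apply: flowd_sum. Qed.

End MatrixFlow.

Section UspFlow.
Context {R : realType} {n : nat}.
Notation C := R[i].
Notation G := (USp C n).
Notation GB := (USpBorel C n).
Notation N := (n + n)%N.
Local Open Scope sesquilinear_scope.

Lemma in_usp_scale (t : R) (A : 'M[C]_N) : in_usp A -> in_usp (t%:C%C *: A).
Proof.
move=> [Ah As]; split; last exact: in_spZ.
rewrite linearZ /= map_mxZ Ah scalerN; congr (- (_ *: _)).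
by rewrite /= -[RHS]conjc_real.
Qed.

Definition usp_flow (A : 'M[C]_N) (hA : in_usp A) (t : R) (g : GB) : GB :=
  (MkUSp (cayley_uspmx _ (in_usp_scale (t / 2) _ hA)) * (g : G))%g.

Lemma normc_usp_entry (g : G) i j : normc (usp_val g i j) <= 1.
Proof.
rewrite normc_le; apply: unitarymx_entry_le1.
by case/andP: (usp_valP g).
Qed.

Lemma mbmeas_usp_val : mbmeas _ _ (fun g : GB => usp_val (g : G)).
Proof.
move=> i j; split.
- by apply: measurable_continuous_usp; exact: continuous_usp_Re.
- by apply: measurable_continuous_usp; exact: continuous_usp_Im.
- by exists 1 => g; exact: normc_usp_entry.
Qed.

Lemma mflowd_usp_val (A : 'M[C]_N) (hA : in_usp A) :
  mflowd (phi := usp_flow A hA) _ _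
    (fun g : GB => usp_val (g : G)) (fun g : GB => A *m usp_val (g : G)).
Proof.
move=> i j; split; first exact: mbmeas_usp_val.
  by apply: mbmeasM; [exact: mbmeas_cst|exact: mbmeas_usp_val].
(* By [cayley_expansion] the error is an entry of [t ^+ 2 / 4 *: A *m A *m (g + h)], where [g] and
   [h] are unitary and so have entries of modulus at most 1. *)
exists (\sum_k normc ((A *m A) i k)) => t g /andP[t0 t1].
set B := (t / 2)%:C%C *: A; have hB : in_usp B := in_usp_scale (t / 2) _ hA.
set h := usp_flow A hA t g.
have hE : usp_val (h : G) = cayley B *m usp_val (g : G) by [].
have e : usp_val (h : G) - usp_val (g : G) - t%:C%C *: (A *m usp_val (g : G)) =
    (t ^+ 2 / 4)%:C%C *: (A *m A *m (usp_val (g : G) + usp_val (h : G))).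
  have -> : (t ^+ 2 / 4)%:C%C *:
    (A *m A *m (usp_val (g : G) + usp_val (h : G))) =
      B *m B *m (1%:M + cayley B) *m usp_val (g : G).
    rewrite -[RHS]mulmxA mulmxDl mul1mx -hE /B -!scalemxAl -!scalemxAr
      -scalemxAl.
    by rewrite scalerA; congr (_ *: _); rewrite -rmorphM; congr (_%:C)%C; field.
  rewrite -cayley_expansion; last by case: hB.
  have -> : 2%:R *: B = t%:C%C *: A.
    rewrite /B scalerA -(rmorph_nat (real_complex R)) -rmorphM.
    by congr (_%:C%C *: _); field.
  by rewrite !mulmxBl mul1mx -hE -scalemxAl.
have -> : usp_val (h : G) i j - usp_val (g : G) i j -
    t%:C%C * (A *m usp_val (g : G)) i j =
    (t ^+ 2 / 4)%:C%C * (A *m A *m (usp_val (g : G) + usp_val (h : G))) i j.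
  by have := congr1 (fun M : 'M[C]_N => M i j) e; rewrite !mxE.
rewrite normcM normc_real ger0_norm ?divr_ge0 ?sqr_ge0//.
have : normc ((A *m A *m (usp_val (g : G) + usp_val (h : G))) i j) <=
    2 * \sum_k normc ((A *m A) i k).
  rewrite mxE (le_trans (normc_sum _ _))// mulr_sumr; apply: ler_sum => k _.
  rewrite normcM mulrC ler_wpM2r ?normc_ge0// mxE.
  rewrite (le_trans (normc_triangle _ _))//.
  by rewrite (_ : 2 = 1 + 1)// lerD// normc_usp_entry.
have S0 : 0 <= \sum_k normc ((A *m A) i k) by apply: sumr_ge0 => k _;
  exact: normc_ge0.
set S := \sum_k _ in S0 *; set z := normc _ => zS.
have t20 : 0 <= t ^+ 2 by exact: sqr_ge0.
have : t ^+ 2 / 4 * z <= t ^+ 2 / 4 * (2 * S) by rewrite ler_wpM2l// divr_ge0.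
have : 0 <= t ^+ 2 * S by rewrite mulr_ge0.
lra.
Qed.

Context {P : probability GB R}.
Hypothesis hP : is_haar P.

Lemma usp_flow_cmean0 (A : 'M[C]_N) (hA : in_usp A) (F F' : GB -> C) :
  flowd (usp_flow A hA) F F' -> cmean (P := P) F' = 0.
Proof.
apply: flowd_cmean0 => t u K mu uK; split.
  by apply: measurableT_comp mu _; exact: measurable_usp_mul.
exact: (haar_integral_mul hP _ _ K).
Qed.

(** Only directions in [in_usp] carry a flow; [in_sp_decomposition] and complex linearity reach the
    matrices [sp_proj (delta_mx i j)]. *)
Lemma cmean_in_sp (L : 'M[C]_N -> GB -> C) :
  (forall a X Y g, L (a *: X + Y) g = a * L X g + L Y g) ->
  (forall X, bmeas (L X)) ->
  (forall A, in_usp A -> cmean (P := P) (L A) = 0) ->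
  forall X, in_sp X -> cmean (P := P) (L X) = 0.
Proof.
move=> linL bL L0 X /in_sp_decomposition[A [B [hA hB ->]]].
rewrite (eq_cmean _ _ (linL _ _ _)) cmeanD//; last first.
  by apply: bmeasM => //; exact: bmeas_cst.
by rewrite cmeanZ// !L0// mulr0 addr0.
Qed.

(* Schwinger-Dyson equation: the mean of the derivative of [M i j * f] in the
   direction [sp_proj (delta_mx i j)] vanishes; summing over [i] and [j] is a
   trace over a basis of the complexified Lie algebra and its dual basis. *)
Lemma schwinger_dyson (M : GB -> 'M[C]_N) (M' : 'M[C]_N -> GB -> 'M[C]_N)
    (f : GB -> C) (f' : 'M[C]_N -> GB -> C) :
  (forall a X Y g, M' (a *: X + Y) g = a *: M' X g + M' Y g) ->
  (forall a X Y g, f' (a *: X + Y) g = a * f' X g + f' Y g) ->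
  mbmeas _ _ M -> (forall X, mbmeas _ _ (M' X)) -> bmeas f ->
  (forall X, bmeas (f' X)) ->
  (forall A (hA : in_usp A), mflowd (phi := usp_flow A hA) _ _ M (M' A)) ->
  (forall A (hA : in_usp A), flowd (usp_flow A hA) f (f' A)) ->
  cmean (P := P) (fun g =>
    (\sum_i \sum_j M' (sp_proj (delta_mx i j)) g i j) * f g +
    \sum_i \sum_j M g i j * f' (sp_proj (delta_mx i j)) g) = 0.
Proof.
move=> linM' linf' bM bM' bf bf' dM df.
pose L i j X g := M' X g i j * f g + M g i j * f' X g.
have bL i j X : bmeas (L i j X).
  apply: bmeasD; first exact: bmeasM (bM' X i j) bf.
  exact: bmeasM (bM i j) (bf' X).
rewrite (eq_cmean _ (fun g => \sum_i \sum_j L i j (sp_proj (delta_mx i j)) g)).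
  rewrite cmean_sum => [|i]; last by apply: bmeas_sum.
  rewrite big1// => i _; rewrite cmean_sum// big1// => j _.
  apply: (cmean_in_sp (L i j)) => //; last exact: in_sp_proj.
    by move=> a X Y g; rewrite /L linM' linf' !mxE; ring.
  by move=> A hA; apply: (usp_flow_cmean0 A hA); apply: flowdM;
    [exact: dM|exact: df].
move=> g; rewrite mulr_suml -big_split; apply: eq_bigr => i _ /=.
by rewrite mulr_suml -big_split.
Qed.

End UspFlow.

(** * Schwinger-Dyson equations for the first two power sums *)

Section TraceMoments.
Context {R : realType} {n : nat}.
Notation C := R[i].
Notation G := (USp C n).
Notation GB := (USpBorel C n).
Notation N := (n + n)%N.
Notation J := (symplectic_form C n).
Context {P : probability GB R}.
Hypothesis hP : is_haar P.

(** Power sums of the eigenvalues, written as the trace function at powers of [g]: reality and the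
    bound by [N] are inherited from [uspW_trace] and [uspW_le]. *)
Definition usp_p2 (g : G) : R := uspW (g * g)%g.
Definition usp_p4 (g : G) : R := usp_p2 (g * g)%g.

Lemma uspW_le (g : G) : `|uspW g| <= N%:R.
Proof.
rewrite -normc_real -uspW_trace (le_trans (normc_sum _ _))//.
apply: (@le_trans _ _ (\sum_(i < N) 1)).
  by apply: ler_sum => i _; exact: normc_usp_entry.
by rewrite sumr_const card_ord.
Qed.

Lemma usp_symplectic (g : G) : (usp_val g)^T *m J *m usp_val g = J.
Proof. by case/andP: (usp_valP g) => _ /eqP. Qed.

Lemma mxtrace_usp2 (g : G) : \tr (usp_val g *m usp_val g) = (usp_p2 g)%:C%C.
Proof. exact: uspW_trace (g * g)%g. Qed.

Lemma bmeas_uspW : bmeas (fun g : GB => (uspW (g : G))%:C%C).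
Proof.
rewrite (_ : (fun _ => _) = (fun g : GB => \tr (usp_val (g : G)))).
  by apply: bmeas_mxtrace; exact: mbmeas_usp_val.
by apply/funext => g; rewrite uspW_trace.
Qed.

Lemma bmeas_usp_p2 : bmeas (fun g : GB => (usp_p2 (g : G))%:C%C).
Proof.
rewrite (_ : (fun _ => _) = (fun g : GB => \tr (usp_val (g : G) *m usp_val (g : G)))).
  by apply: bmeas_mxtrace; apply: mbmeasM; exact: mbmeas_usp_val.
by apply/funext => g; rewrite mxtrace_usp2.
Qed.

Lemma usp_trace_JJ (g : G) : \tr ((usp_val g)^T *m J *m usp_val g *m J) =
  - N%:R.
Proof.
by rewrite usp_symplectic mulmx_symplectic_form raddfN /= mxtrace1.
Qed.

(** The case [M = g] with the function [f (W)]. The Casimir scalar gives [N + 1]; the derivative of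
    [f (W)] gives [p2 - N], where [- N] is the trace of [g^T J g J = J J]. *)
Lemma schwinger_dyson_trace (f f' : R -> R) : C11_on N%:R f f' ->
  \int[P]_g ((N%:R + 1) * uspW g * f (uspW g) + f' (uspW g) * (usp_p2 g - N%:R)) = 0.
Proof.
move=> ff'.
have dW A (hA : in_usp A) : flowd (usp_flow A hA)
    (fun g : GB => (uspW (g : G))%:C%C)
      (fun g : GB => \tr (A *m usp_val (g : G))).
  apply: (eq_flowd _ (fun g : GB => \tr (usp_val (g : G)))) => [g|//|].
    by rewrite uspW_trace.
  exact/flowd_mxtrace/mflowd_usp_val.
have [mf mf' [K hK]] := ff'.
have [mW _ _] := bmeas_uspW.
have bf : bmeas (fun g : GB => (f (uspW (g : G)))%:C%C).
  apply: (bmeas_real _ K); first exact: measurableT_comp mf mW.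
  by move=> g; have [] := hK _ _ (uspW_le g) (uspW_le g).
have bf' : bmeas (fun g : GB => (f' (uspW (g : G)))%:C%C).
  apply: (bmeas_real _ K); first exact: measurableT_comp mf' mW.
  by move=> g; have [] := hK _ _ (uspW_le g) (uspW_le g).
have bX (X : 'M[C]_N) : mbmeas _ _ (fun g : GB => X *m usp_val (g : G)).
  by apply: mbmeasM; [exact: mbmeas_cst|exact: mbmeas_usp_val].
have lM (a : C) (X Y : 'M[C]_N) (g : GB) : (a *: X + Y) *m usp_val (g : G) =
    a *: (X *m usp_val (g : G)) + Y *m usp_val (g : G).
  by rewrite mulmxDl -scalemxAl.
have lf (a : C) (X Y : 'M[C]_N) (g : GB) :
  (f' (uspW (g : G)))%:C%C * \tr ((a *: X + Y) *m usp_val (g : G)) =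
    a * ((f' (uspW (g : G)))%:C%C * \tr (X *m usp_val (g : G))) +
    (f' (uspW (g : G)))%:C%C * \tr (Y *m usp_val (g : G)).
  by rewrite lM raddfD /= mxtraceZ; ring.
have H := schwinger_dyson hP _ (fun X (g : GB) => X *m usp_val (g : G)) _
  (fun X (g : GB) => (f' (uspW (g : G)))%:C%C * \tr (X *m usp_val (g : G)))
  lM lf mbmeas_usp_val bX bf (fun X => bmeasM _ _ bf' (bmeas_mxtrace _ _ (bX X)))
  mflowd_usp_val (fun A hA => flowd_comp _ _ _ _ (fun g : GB => uspW (g : G)) _ ff' uspW_le (dW A hA)).
apply: complexI; rewrite -cmean_real /= -[RHS]H.
apply: eq_cmean => g; rewrite sum_sp_proj_mul.
  have -> : \sum_i \sum_j usp_val (g : G) i j * ((f' (uspW (g : G)))%:C%C *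
      \tr (sp_proj (delta_mx i j) *m usp_val (g : G))) =
      (f' (uspW (g : G)))%:C%C * (\sum_i \sum_j usp_val (g : G) i j *
      \tr (sp_proj (delta_mx i j) *m usp_val (g : G))).
    rewrite mulr_sumr; apply: eq_bigr => i _; rewrite mulr_sumr.
    by apply: eq_bigr => j _; rewrite mulrCA.
  rewrite sum_mxtrace_sp_proj usp_trace_JJ mxtrace_usp2 uspW_trace.
  by rewrite !(rmorphD, rmorphM, rmorphB, rmorphN, rmorph_nat, rmorph1).
Qed.

(** The case [M = g g], whose derivative is [X g g + g X g]: the first term contracts to
    [(N + 1) p2], the second to [W^2 + N]. The contraction of the derivative of [f] is left as [D],
    to be computed for [f = 1] and [f = p2]. *)
Lemma schwinger_dyson_p2 (f : GB -> R) (f' : 'M[C]_N -> GB -> C) (D : G -> R) :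
  (forall a X Y g, f' (a *: X + Y) g = a * f' X g + f' Y g) ->
  bmeas (fun g => (f g)%:C%C) -> (forall X, bmeas (f' X)) ->
  (forall A (hA : in_usp A), flowd (usp_flow A hA) (fun g => (f g)%:C%C) (f' A)) ->
  (forall g : G, \sum_i \sum_j (usp_val g *m usp_val g) i j *
     f' (sp_proj (delta_mx i j)) g = (D g)%:C%C) ->
  \int[P]_g (((N%:R + 1) * usp_p2 g + uspW g ^+ 2 + N%:R) * f g + D g) = 0.
Proof.
move=> linf' bf bf' df hD.
have bv := @mbmeas_usp_val R n.
have bX (X : 'M[C]_N)
  : mbmeas _ _ (fun g : GB => X *m usp_val (g : G) *m usp_val (g : G) +
    usp_val (g : G) *m (X *m usp_val (g : G))).
  by apply: mbmeasD; repeat apply: mbmeasM => //; exact: mbmeas_cst.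
have lM (a : C) (X Y : 'M[C]_N) (g : GB) :
  (a *: X + Y) *m usp_val (g : G) *m usp_val (g : G) +
    usp_val (g : G) *m ((a *: X + Y) *m usp_val (g : G)) =
    a *: (X *m usp_val (g : G) *m usp_val (g : G) +
    usp_val (g : G) *m (X *m usp_val (g : G))) +
    (Y *m usp_val (g : G) *m usp_val (g : G) +
    usp_val (g : G) *m (Y *m usp_val (g : G))).
  by rewrite !(mulmxDl, mulmxDr) -!(scalemxAl, scalemxAr) scalerDr addrACA.
have H := schwinger_dyson hP _ (fun X (g : GB) =>
    X *m usp_val (g : G) *m usp_val (g : G) + usp_val (g : G)
      *m (X *m usp_val (g : G)))
  _ f' lM linf' (mbmeasM _ _ _ _ _ bv bv) bX bf bf'
  (fun A hA => mflowdM _ _ _ _ _ _ _ (mflowd_usp_val A hA) (mflowd_usp_val A hA)) df.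
apply: complexI; rewrite -cmean_real /= -[RHS]H.
apply: eq_cmean => g; rewrite hD.
  have -> : \sum_i \sum_j (sp_proj (delta_mx i j) *m usp_val (g : G) *m usp_val (g : G) +
      usp_val (g : G) *m (sp_proj (delta_mx i j) *m usp_val (g : G))) i j =
      \sum_i \sum_j (sp_proj (delta_mx i j) *m (usp_val (g : G) *m usp_val (g : G))) i j +
      \sum_i \sum_j (usp_val (g : G) *m sp_proj (delta_mx i j) *m usp_val (g : G)) i j.
    rewrite -big_split; apply: eq_bigr => i _; rewrite -big_split.
    by apply: eq_bigr => j _; rewrite mxE !mulmxA.
  rewrite sum_sp_proj_mul sum_mul_sp_proj_mul mxtrace_usp2 uspW_trace.
  (* Cyclicity brings the twisted trace to the form [g^T J g J], so that subtracting it adds [N]. *)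
  rewrite -!mulmxA mxtrace_mulC !mulmxA usp_trace_JJ.
  rewrite !(rmorphD, rmorphM, rmorphXn, rmorph_nat, rmorph1) /=.
  by ring.
Qed.

Lemma schwinger_dyson_p2_1 :
  \int[P]_g ((N%:R + 1) * usp_p2 g + uspW g ^+ 2 + N%:R) = 0.
Proof.
have := schwinger_dyson_p2 (fun=> 1) (fun _ _ => 0) (fun=> 0).
under eq_Rintegral do rewrite mulr1 addr0.
apply => //.
- by move=> *; rewrite mulr0 addr0.
- exact: bmeas_cst.
- by move=> X; exact: bmeas_cst.
- by move=> A hA; exact: flowd_cst.
- by move=> g; rewrite big1// => i _; rewrite big1// => j _; rewrite mulr0.
Qed.

Lemma schwinger_dyson_p2_p2 :
  \int[P]_g (((N%:R + 1) * usp_p2 g + uspW g ^+ 2 + N%:R) * usp_p2 g +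
    2 * (usp_p4 g - N%:R)) = 0.
Proof.
have bv := @mbmeas_usp_val R n.
have lM (a : C) (X Y : 'M[C]_N) (g : GB) :
    2 * \tr ((a *: X + Y) *m (usp_val (g : G) *m usp_val (g : G))) =
    a * (2 * \tr (X *m (usp_val (g : G) *m usp_val (g : G)))) +
    2 * \tr (Y *m (usp_val (g : G) *m usp_val (g : G))).
  by rewrite mulmxDl -scalemxAl raddfD /= mxtraceZ; ring.
apply: (schwinger_dyson_p2 _ (fun X (g : GB) =>
    2 * \tr (X *m (usp_val (g : G) *m usp_val (g : G)))) _ lM bmeas_usp_p2).
- move=> X; apply: bmeasM; first exact: bmeas_cst.
  apply: bmeas_mxtrace; apply: mbmeasM; first exact: mbmeas_cst.
  exact: mbmeasM.
- move=> A hA; apply: eq_flowd (flowd_mxtrace _ _ _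
    (mflowdM _ _ _ _ _ _ _ (mflowd_usp_val A hA) (mflowd_usp_val A hA))) => g.
    by rewrite mxtrace_usp2.
  by rewrite raddfD /= [X in _ + X]mxtrace_mulC -!mulmxA; ring.
- move=> g.
  transitivity (2 * \sum_i \sum_j (usp_val (g : G) *m usp_val (g : G)) i j *
      \tr (sp_proj (delta_mx i j) *m (usp_val (g : G) *m usp_val (g : G)))).
    rewrite mulr_sumr; apply: eq_bigr => i _; rewrite mulr_sumr.
    by apply: eq_bigr => j _; rewrite mulrCA.
  rewrite sum_mxtrace_sp_proj (mxtrace_usp2 (g * g)%g) (usp_trace_JJ (g * g)%g).
  by rewrite !(rmorphM, rmorphB, rmorph_nat).
Qed.

End TraceMoments.
Section BoundedMean.
Context {R : realType} {d : measure_display} {T : measurableType d}.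
Context {P : probability T R}.
Implicit Types u v : T -> R.

Definition bounded_mfun u := measurable_fun setT u /\
  exists K, forall x, `|u x| <= K.

Lemma bounded_mfun_cst (c : R) : bounded_mfun (fun=> c).
Proof. by split => //; exists `|c|. Qed.

Lemma bounded_mfunD u v : bounded_mfun u -> bounded_mfun v ->
  bounded_mfun (fun x => u x + v x).
Proof.
move=> [mu [K uK]] [mv [L vL]]; split; first exact: measurable_funD.
by exists (K + L) => x; rewrite (le_trans (ler_normD _ _))// lerD.
Qed.

Lemma bounded_mfunM u v : bounded_mfun u -> bounded_mfun v ->
  bounded_mfun (fun x => u x * v x).
Proof.
move=> [mu [K uK]] [mv [L vL]]; split; first exact: measurable_funM.
by exists (K * L) => x; rewrite normrM ler_pM.
Qed.

Lemma bounded_mfun_norm u : bounded_mfun u -> bounded_mfun (fun x => `|u x|).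
Proof.
move=> [mu [K uK]]; split; first exact: measurableT_comp.
by exists K => x; rewrite normr_id.
Qed.

Lemma bounded_mfun_integrable u : bounded_mfun u ->
  P.-integrable setT (EFin \o u).
Proof. by move=> [mu [K uK]]; exact: integrable_bounded mu uK. Qed.

Lemma bounded_meanD u v : bounded_mfun u -> bounded_mfun v ->
  \int[P]_x (u x + v x) = \int[P]_x u x + \int[P]_x v x.
Proof.
by move=> hu hv; rewrite RintegralD//; exact: bounded_mfun_integrable.
Qed.

Lemma bounded_meanZ (c : R) u : bounded_mfun u ->
  \int[P]_x (c * u x) = c * \int[P]_x u x.
Proof. by move=> hu; rewrite RintegralZl//; exact: bounded_mfun_integrable. Qed.

Lemma bounded_mean_cst (c : R) : \int[P]_x c = c.
Proof.
by rewrite Rintegral_cst// -[RHS]mulr1; congr (_ * _);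
  exact: (congr1 fine (probability_setT P)).
Qed.

Lemma le_bounded_mean u v : bounded_mfun u -> bounded_mfun v ->
  (forall x, u x <= v x) -> \int[P]_x u x <= \int[P]_x v x.
Proof.
by move=> hu hv uv; apply: le_Rintegral => //; exact: bounded_mfun_integrable.
Qed.

End BoundedMean.

(** * Moment bounds and Stein's method for the trace *)

Section SteinUsp.
Context {R : realType} {n : nat}.
Notation G := (USp R[i] n).
Notation GB := (USpBorel R[i] n).
Notation N := (n + n)%N.
Context {P : probability GB R}.
Hypothesis hP : is_haar P.
Hypothesis n0 : (0 < n)%N.

Let W (g : GB) : R := uspW (g : G).
Let p2 (g : GB) : R := usp_p2 (g : G).

Let bW : bounded_mfun W.
Proof.
by have [m _ _] := @bmeas_uspW R n; split => //; exists N%:R => g;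
  exact: uspW_le.
Qed.

Let bp2 : bounded_mfun p2.
Proof.
by have [m _ _] := @bmeas_usp_p2 R n; split => //; exists N%:R => g;
  exact: uspW_le.
Qed.

Lemma bmeas_usp_p4 : bmeas (fun g : GB => (usp_p4 (g : G))%:C%C).
Proof.
have bv := @mbmeas_usp_val R n.
rewrite (_ : (fun _ => _) = (fun g : GB =>
    \tr ((usp_val (g : G) *m usp_val (g : G)) *m (usp_val (g : G) *m usp_val (g : G))))).
  by apply: bmeas_mxtrace; do 2 (apply: mbmeasM => //); exact: mbmeasM.
by apply/funext => g; rewrite -(mxtrace_usp2 (g * g)%g).
Qed.

Let p4 (g : GB) : R := usp_p4 (g : G).

Let bp4 : bounded_mfun p4.
Proof.
by have [m _ _] := bmeas_usp_p4; split => //; exists N%:R => g; exact: uspW_le.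
Qed.

Let bW2 : bounded_mfun (fun g => W g ^+ 2).
Proof. by under eq_fun do rewrite expr2; exact: bounded_mfunM. Qed.

Let N0 : 0 < N%:R :> R.
Proof. by rewrite ltr0n addn_gt0 n0. Qed.

Lemma uspW_p2_moments : \int[P]_g W g ^+ 2 = 1 /\ \int[P]_g p2 g = -1.
Proof.
have := schwinger_dyson_trace hP _ _ (C11_on_id N%:R).
have := schwinger_dyson_p2_1 hP.
under eq_Rintegral do rewrite -addrA.
rewrite bounded_meanD; last 2 first.
- by apply: bounded_mfunM => //; exact: bounded_mfun_cst.
- by apply: bounded_mfunD => //; exact: bounded_mfun_cst.
rewrite bounded_meanZ// bounded_meanD//; last exact: bounded_mfun_cst.
rewrite bounded_mean_cst.
under [X in _ -> X = _ -> _]eq_Rintegral do rewrite mul1r -mulrA -expr2.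
rewrite bounded_meanD; last 2 first.
- by apply: bounded_mfunM => //; exact: bounded_mfun_cst.
- by apply: bounded_mfunD => //; exact: bounded_mfun_cst.
rewrite bounded_meanZ// bounded_meanD//; last exact: bounded_mfun_cst.
rewrite bounded_mean_cst.
set a := \int[P]_g W g ^+ 2; set b := \int[P]_g p2 g.
move=> e1 e2.
(* The two equations read [(N + 1) a + b = N] and [(N + 1) b + a = - N]. Their sum has the factor
   [N + 2], and [b = - a] then leaves [N (a - 1) = 0]. *)
have ab : a + b = 0.
  have : (N%:R + 2) * (a + b) = 0 by lra.
  by move/eqP; rewrite mulf_eq0 gt_eqF ?addr_gt0//= => /eqP.
have : N%:R * (a - 1) = 0 by lra.
by move/eqP; rewrite mulf_eq0 gt_eqF//= subr_eq0 => /eqP a1; split => //; lra.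
Qed.

(** In [schwinger_dyson_p2_p2] the terms other than the square contribute at most [N] from
    [W^2 p2 >= - N W^2], [N] from the mean of [p2], [2 N] from [p4 >= - N], and the constant
    [2 N]. *)
Lemma usp_p2_second_moment : (N%:R + 1) * \int[P]_g p2 g ^+ 2 <= 6 * N%:R.
Proof.
have [ea eb] := uspW_p2_moments.
have bp22 : bounded_mfun (fun g => p2 g ^+ 2).
  by under eq_fun do rewrite expr2; exact: bounded_mfunM.
have bWp : bounded_mfun (fun g => W g ^+ 2 * p2 g) by exact: bounded_mfunM.
have bc (c : R) (u : GB -> R) : bounded_mfun u ->
  bounded_mfun (fun g => c * u g).
  by move=> bu; apply: bounded_mfunM => //; exact: bounded_mfun_cst.
have q : - N%:R <= \int[P]_g (W g ^+ 2 * p2 g).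
  rewrite (_ : - N%:R = \int[P]_g (- N%:R * W g ^+ 2)); last first.
    by rewrite bounded_meanZ// ea mulr1.
  apply: le_bounded_mean => // [|g]; first exact: bc.
  rewrite mulrC ler_wpM2l ?sqr_ge0//.
  by have := uspW_le (g * g : G)%g; rewrite ler_norml => /andP[l _]; exact: l.
have e : - N%:R <= \int[P]_g p4 g.
  rewrite -[leLHS](bounded_mean_cst (P := P)).
  apply: le_bounded_mean => // [|g]; first exact: bounded_mfun_cst.
  by have := uspW_le ((g * g) * (g * g) : G)%g;
    rewrite ler_norml => /andP[l _]; exact: l.
have := schwinger_dyson_p2_p2 hP.
have -> : \int[P]_g (((N%:R + 1) * usp_p2 g + uspW g ^+ 2 + N%:R) * usp_p2 g +
    2 * (usp_p4 g - N%:R)) =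
  \int[P]_g ((N%:R + 1) * p2 g ^+ 2 + (W g ^+ 2 * p2 g + (N%:R * p2 g +
    (2 * p4 g + - (2 * N%:R))))).
  by apply: eq_Rintegral => g _; rewrite /p2 /W /p4; ring.
rewrite bounded_meanD; [|exact: bc|].
  rewrite bounded_meanD//.
    rewrite bounded_meanD; [|exact: bc|].
      rewrite bounded_meanD; [|exact: bc|exact: bounded_mfun_cst].
      rewrite !bounded_meanZ// bounded_mean_cst eb.
      lra.
    by apply: bounded_mfunD; [exact: bc|exact: bounded_mfun_cst].
  apply: bounded_mfunD; first exact: bc.
  by apply: bounded_mfunD; [exact: bc|exact: bounded_mfun_cst].
apply: bounded_mfunD => //; apply: bounded_mfunD; first exact: bc.
by apply: bounded_mfunD; [exact: bc|exact: bounded_mfun_cst].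
Qed.

Lemma stein_usp (f f' h : R -> R) (m : R) :
  C11_on N%:R f f' -> measurable_fun setT h ->
  (forall x, f' x = x * f x + h x - m) -> (forall x, `|f' x| <= 1) ->
  `|\int[P]_g h (W g) - m| <= Num.sqrt 2 / n%:R.
Proof.
move=> ff' mh fE f'1.
have [ea eb] := uspW_p2_moments; have ec := usp_p2_second_moment.
have [mf mf' [K hK]] := ff'; have [mW _] := bW.
have bf : bounded_mfun (fun g => f (W g)).
  split; first exact: measurableT_comp mf mW.
  by exists K => g; have [] := hK _ _ (uspW_le (g : G)) (uspW_le (g : G)).
have bf' : bounded_mfun (fun g => f' (W g)).
  by split; [exact: measurableT_comp mf' mW|exists 1].
have bc (c : R) (u : GB -> R) : bounded_mfun u ->
  bounded_mfun (fun g => c * u g).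
  by move=> bu; apply: bounded_mfunM => //; exact: bounded_mfun_cst.
have cc := @bounded_mfun_cst R _ GB.
have bh : bounded_mfun (fun g => h (W g)).
  rewrite (_ : (fun _ => _) = (fun g => f' (W g) + (-1 * (W g * f (W g)) + m))).
    apply: bounded_mfunD => //; apply: bounded_mfunD => //; apply: bc.
    exact: bounded_mfunM.
  by apply/funext => g; rewrite fE; ring.
have N1 : 0 < N%:R + 1 :> R by rewrite addr_gt0.
(* Stein's equation replaces [W f] by [f' - h + m]; the coefficient of [f'] becomes
   [(N + 1) + (p2 - N) = 1 + p2]. *)
have key : (N%:R + 1) * (\int[P]_g h (W g) - m) =
  \int[P]_g (f' (W g) * (1 + p2 g)).
  have := schwinger_dyson_trace hP _ _ ff'.
  have -> : \int[P]_g ((N%:R + 1) * uspW g * f (uspW g) +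
      f' (uspW g) * (usp_p2 g - N%:R)) =
    \int[P]_g (f' (W g) * (1 + p2 g) + (- (N%:R + 1) * h (W g) + (N%:R + 1) * m)).
    by apply: eq_Rintegral => g _; rewrite -/(W g) -/(p2 g) (fE (W g)); ring.
  rewrite bounded_meanD.
  - rewrite bounded_meanD; [|exact: bc|exact: cc].
    by rewrite (bounded_meanZ _ _ bh) bounded_mean_cst; lra.
  - by apply: bounded_mfunM => //; exact: bounded_mfunD.
  - by apply: bounded_mfunD; [exact: bc|exact: cc].
set D := Num.sqrt 2 / n%:R.
have D0 : 0 < D by rewrite divr_gt0 ?sqrtr_gt0// ltr0n.
pose t := (N%:R + 1) * D; have t0 : 0 < t by rewrite mulr_gt0.
have bY : bounded_mfun (fun g => 1 + p2 g) by exact: bounded_mfunD.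
have bY2 : bounded_mfun (fun g => (1 + p2 g) ^+ 2).
  by under eq_fun do rewrite expr2; exact: bounded_mfunM.
have var : \int[P]_g (1 + p2 g) ^+ 2 = \int[P]_g p2 g ^+ 2 - 1.
  have -> : \int[P]_g (1 + p2 g) ^+ 2 = \int[P]_g (p2 g ^+ 2 + (2 * p2 g + 1)).
    by apply: eq_Rintegral => g _; ring.
  rewrite bounded_meanD.
  - by rewrite bounded_meanD; [|exact: bc|exact: cc];
      rewrite bounded_meanZ// bounded_mean_cst eb; lra.
  - by under eq_fun do rewrite expr2; exact: bounded_mfunM.
  - by apply: bounded_mfunD; [exact: bc|exact: cc].
have t2 : \int[P]_g (1 + p2 g) ^+ 2 <= t ^+ 2.
  rewrite var /t /D exprMn expr_div_n sqr_sqrtr//.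
  have n1 : 1 <= n%:R :> R by rewrite ler1n.
  set c := \int[P]_g _ in ec *.
  have Nn : N%:R = 2 * n%:R :> R by rewrite natrD mulr_natl.
  rewrite Nn in ec N1 *; set x := n%:R in ec N1 n1 *.
  have x2 : 0 < x ^+ 2 by rewrite exprn_gt0//; lra.
  (* With denominators cleared, the moment bound gives at most [12 * x ^+ 3] on the left, while the
     right side [2 * (2 * x + 1) ^+ 3] already contains [16 * x ^+ 3]. *)
  rewrite mulrA ler_pdivlMr// -(ler_pM2l N1).
  have : ((2 * x + 1) * c) * x ^+ 2 <= (6 * (2 * x)) * x ^+ 2.
    by rewrite ler_wpM2r// ltW.
  have : 0 <= x ^+ 3 by rewrite exprn_ge0//; lra.
  rewrite exprS; lra.
(* In place of the Cauchy-Schwarz inequality, [y <= y ^+ 2 / (2 * t) + t / 2] holds pointwise for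
   [y = |1 + p2|]; since the mean of [y ^+ 2] is at most [t ^+ 2], the two halves add up to [t]. *)
have ub : \int[P]_g `|f' (W g) * (1 + p2 g)| <= t.
  have -> : t = (2 * t)^-1 * t ^+ 2 + t / 2 by field; rewrite gt_eqF.
  apply: (@le_trans _ _ ((2 * t)^-1 * \int[P]_g (1 + p2 g) ^+ 2 + t / 2));
    last first.
    by rewrite lerD2r ler_wpM2l// invr_ge0 mulr_ge0// ltW.
  rewrite -bounded_meanZ// -[X in _ + X](bounded_mean_cst (P := P))
    -bounded_meanD//;
    last exact: bc.
  apply: le_bounded_mean => //.
  - by apply: bounded_mfun_norm; exact: bounded_mfunM.
  - by apply: bounded_mfunD => //; exact: bc.
  move=> g; rewrite normrM; apply: (@le_trans _ _ `|1 + p2 g|).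
    by rewrite ler_piMl.
  rewrite -[X in _ <= _ * X + _]real_normK ?num_real//.
  set y := `|1 + p2 g|.
  rewrite -subr_ge0 (_ : _ - _ = (2 * t)^-1 * (y - t) ^+ 2).
    by rewrite mulr_ge0 ?sqr_ge0// invr_ge0 mulr_ge0// ltW.
  by field; rewrite gt_eqF.
rewrite -(ler_pM2l N1) -/t -[X in X * `|_|](gtr0_norm N1) -normrM key.
apply: le_trans (le_normr_Rintegral _ _) ub => //.
by apply: bounded_mfun_integrable; exact: bounded_mfunM.
Qed.

End SteinUsp.

Theorem theorem3p9 (R : realType) (n : nat) (hn : (2 <= n)%N)
    (P : probability (USpBorel R[i] n) R) (hP : is_haar P) (x0 : R) :
  `| fine (P [set g | uspW g <= x0])
     - (Num.sqrt (2 * pi))^-1 *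
       \int[lebesgue_measure]_(x in `]-oo, x0]) expR (- (x ^+ 2 / 2)) |
    <= Num.sqrt 2 / n%:R.
Proof.
have n0 : (0 < n)%N by exact: leq_trans hn.
have [mW _ _] := @bmeas_uspW R n.
have H y e : 0 < e ->
    `|\int[P]_g ramp y e (uspW (g : USp R[i] n)) - gauss_mean (ramp y e)| <=
    Num.sqrt 2 / n%:R.
  move=> e0; have ch := @continuous_ramp R y e.
  have h0 := ramp_ge0 y e; have h1 := ramp_le1 y e.
  apply: (stein_usp hP n0 (stein_sol (ramp y e)) (stein_sol' (ramp y e))) => //.
  (* The slope [e^-1] only certifies regularity and does not enter the bound, which is therefore
     uniform in [e]. *)
  - apply: (C11_on_stein_sol _ e^-1) => // x z; exact: ramp_lipschitz.
  - exact: continuous_measurable_fun.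
  - by move=> x; exact: stein_sol'_le1.
have := kolmogorov_of_ramp P (fun g => uspW (g : USp R[i] n)) mW _ H x0.
rewrite /gauss_cdf /gauss_pdf RintegralZl//.
by apply: (integrableS _ _ _ integrable_gauss_exp).
Qed.
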